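(* Let $G$ be a group which is not virtually cyclic, acting properly by isometries on a geodesic metric space $X$, and assume $G$ contains a strongly contracting element. Let $H$ be an infinite index quasi-convex subgroup of $G$. Then $\omega_H<\omega_G$ and $\omega_{G/H}=\omega_{H\backslash G}=\omega_G$.
   Context: A subset $A\subseteq X$ is $\delta$-strongly contracting if for every closed ball $B$ of $X$ disjoint from $A$, the nearest-point projection of $B$ onto $A$ (the set of points of $A$ realizing the distance to points of $B$) has diameter less than $\delta$. An element $g\in G$ is strongly contracting if it has infinite order and there exist $o\in X$ and $\delta\ge0$ such that the orbit $\langle g\rangle o$ is $\delta$-strongly contracting. A subgroup $H$ is quasi-convex if there are $o\in X$, $\eta\ge 0$ such that every geodesic of $X$ with endpoints in $Ho$ lies in the $\eta$-neighbourhood of $Ho$. The action is proper if $B_G(x,r)=\{g\in G: d(x,gx)\le r\}$ is finite for all $x,r$. For $o\in X$: $\omega_H=\limsup_{r\to\infty}\frac1r\log|B_G(o,r)\cap H|$, $\omega_G$ likewise with $H=G$, $\omega_{G/H}=\limsup_{r\to\infty}\frac1r\log|\mathcal L(B_G(o,r))|$ and $\omega_{H\backslash G}=\limsup_{r\to\infty}\frac1r\log|\mathcal R(B_G(o,r))|$, where $\mathcal L\colon G\to G/H$ and $\mathcal R\colon G\to H\backslash G$ are the natural maps to left and right cosets. *)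

(* Defs.v *)
From Stdlib Require Import Reals List ZArith.
From Coquelicot Require Import Coquelicot.
Open Scope R_scope.

Record Group := {
  gcar :> Type;
  gmul : gcar -> gcar -> gcar;
  ginv : gcar -> gcar;
  gone : gcar;
  gmul_assoc : forall a b c, gmul a (gmul b c) = gmul (gmul a b) c;
  gmul_1l : forall a, gmul gone a = a;
  gmul_Vl : forall a, gmul (ginv a) a = gone
}.

Arguments gmul {g}. Arguments ginv {g}. Arguments gone {g}.

Fixpoint gpow {G : Group} (g : G) (n : nat) : G :=
  match n with O => gone | S m => gmul g (gpow g m) end.

Definition gzpow {G : Group} (g : G) (k : Z) : G :=
  match k with
  | Z0 => gone
  | Zpos p => gpow g (Pos.to_nat p)
  | Zneg p => ginv (gpow g (Pos.to_nat p))
  end.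

Definition is_subgroup {G : Group} (H : G -> Prop) : Prop :=
  H gone /\ (forall a b, H a -> H b -> H (gmul a b)) /\ (forall a, H a -> H (ginv a)).

Definition finite_index {G : Group} (H : G -> Prop) : Prop :=
  exists l : list G, forall g, exists a, In a l /\ H (gmul (ginv a) g).

Definition virtually_cyclic (G : Group) : Prop :=
  exists K : G -> Prop, is_subgroup K /\ finite_index K /\
    exists a : G, forall k, K k <-> exists n : Z, k = gzpow a n.

Record MetricSpace := {
  mcar :> Type;
  dist : mcar -> mcar -> R;
  dist_refl : forall x, dist x x = 0;
  dist_sep : forall x y, dist x y = 0 -> x = y;
  dist_sym : forall x y, dist x y = dist y x;
  dist_tri : forall x y z, dist x z <= dist x y + dist y z
}.

Arguments dist {m}.

Definition geodesic_segment {X : MetricSpace} (x y : X) (gam : R -> X) : Prop :=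
  gam 0 = x /\ gam (dist x y) = y /\
  forall s t, 0 <= s <= dist x y -> 0 <= t <= dist x y ->
    dist (gam s) (gam t) = Rabs (s - t).

Definition geodesic_space (X : MetricSpace) : Prop :=
  forall x y : X, exists gam, geodesic_segment x y gam.

Definition isometric_action {G : Group} {X : MetricSpace} (act : G -> X -> X) : Prop :=
  (forall x, act gone x = x) /\
  (forall g h x, act (gmul g h) x = act g (act h x)) /\
  (forall g x y, dist (act g x) (act g y) = dist x y).

Definition proper_action {G : Group} {X : MetricSpace} (act : G -> X -> X) : Prop :=
  forall (x : X) (r : R), exists l : list G,
    forall g, dist x (act g x) <= r -> In g l.

Definition setdist {X : MetricSpace} (A : X -> Prop) (y : X) : Rbar :=
  Glb_Rbar (fun r => exists a, A a /\ r = dist y a).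

Definition nproj {X : MetricSpace} (A : X -> Prop) (y a : X) : Prop :=
  A a /\ setdist A y = Finite (dist y a).

Definition diam {X : MetricSpace} (S : X -> Prop) : Rbar :=
  Lub_Rbar (fun r => exists a b, S a /\ S b /\ r = dist a b).

Definition strongly_contracting_set {X : MetricSpace} (A : X -> Prop) (delta : R) : Prop :=
  forall (c : X) (rho : R),
    (forall y, dist c y <= rho -> ~ A y) ->
    Rbar_lt (diam (fun a => exists y, dist c y <= rho /\ nproj A y a)) (Finite delta).

Definition strongly_contracting_elt {G : Group} {X : MetricSpace}
  (act : G -> X -> X) (g : G) : Prop :=
  (forall n : nat, (0 < n)%nat -> gpow g n <> gone) /\
  exists (o : X) (delta : R), 0 <= delta /\
    strongly_contracting_set (fun x => exists k : Z, x = act (gzpow g k) o) delta.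

Definition quasi_convex {G : Group} {X : MetricSpace} (act : G -> X -> X)
  (H : G -> Prop) : Prop :=
  exists (o : X) (eta : R), 0 <= eta /\
    forall h1 h2 gam, H h1 -> H h2 ->
      geodesic_segment (act h1 o) (act h2 o) gam ->
      forall t, 0 <= t <= dist (act h1 o) (act h2 o) ->
        exists h, H h /\ dist (gam t) (act h o) <= eta.

Fixpoint pairwise_inequiv {T : Type} (E : T -> T -> Prop) (l : list T) : Prop :=
  match l with
  | nil => True
  | a :: t => (forall b, In b t -> ~ E a b) /\ pairwise_inequiv E t
  end.

(** number of E-classes meeting P (in [0, +oo]); for E = eq this is |P| *)
Definition card_classes {T : Type} (P : T -> Prop) (E : T -> T -> Prop) : Rbar :=
  Lub_Rbar (fun x => exists l : list T,
    (forall a, In a l -> P a) /\ pairwise_inequiv E l /\ x = INR (length l)).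

(** limsup_{r -> oo} (1/r) log N(r), in the extended reals *)
Definition growth_rate (N : R -> Rbar) : Rbar :=
  Glb_Rbar (fun y => exists T, 0 < T /\
    Finite y = Lub_Rbar (fun z => exists (r : R) (n : nat),
       T <= r /\ Rbar_le (Finite (INR n)) (N r) /\ z = ln (INR n) / r)).

Definition ballG {G : Group} {X : MetricSpace} (act : G -> X -> X) (o : X) (r : R)
  (g : G) : Prop := dist o (act g o) <= r.

Definition omega_sub {G : Group} {X : MetricSpace} (act : G -> X -> X)
  (H : G -> Prop) (o : X) : Rbar :=
  growth_rate (fun r => card_classes (fun g => ballG act o r g /\ H g) eq).

Definition omega_grp {G : Group} {X : MetricSpace} (act : G -> X -> X) (o : X) : Rbar :=
  growth_rate (fun r => card_classes (ballG act o r) eq).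

Definition omega_left_cosets {G : Group} {X : MetricSpace} (act : G -> X -> X)
  (H : G -> Prop) (o : X) : Rbar :=
  growth_rate (fun r => card_classes (ballG act o r) (fun a b => H (gmul (ginv a) b))).

Definition omega_right_cosets {G : Group} {X : MetricSpace} (act : G -> X -> X)
  (H : G -> Prop) (o : X) : Rbar :=
  growth_rate (fun r => card_classes (ballG act o r) (fun a b => H (gmul a (ginv b)))).

(* Main.v *)
Require Import Defs.
From Stdlib Require Import Reals List ZArith Lra Lia Classical ClassicalEpsilon FinFun.
From Coquelicot Require Import Coquelicot.
Import Defs.
Open Scope R_scope.

(** Let [A] be the axis of a strongly contracting element. Either a geodesic between two
    points passes near their projections to [A], or these projections are close. As [G] is
    not virtually cyclic, some translate [eA] has bounded projection to [A]; if [H] is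
    quasi-convex of infinite index, this forces some translate of [A] to be transverse to
    [H] (bounded projection of the [H]-orbit). Calling [Far] the group elements whose orbit
    point projects far from a base point of that translate, a Behrstock-type inequality
    shows that only finitely many [h] in [H] send a [Far] element to a [Far] element, while
    a high power [f] of the contracting element sends every non-[Far] element to a [Far] one.

    This ping-pong suffices for the growth statements. Sending [g] to [g] or [f g],
    whichever is [Far], is finite-to-one modulo [H] on the left, so [H\G] grows like [G];
    inversion exchanges left and right cosets. If [H] is infinite, quasi-convexity makes its
    ball sizes submultiplicative, so its Poincare series diverges at [omega_H]; one can then
    choose letters in [H] for which the words [f h1 f h2 ...] are pairwise distinct and
    already have an exponent larger than [omega_H]. A finite [H] is dominated by the cyclic
    group of the contracting element. *)

(** * Groups and powers *)

Section GroupLaws.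
Context {G : Group}.
Implicit Types a b c g : G.

Lemma gmul_Vr a : gmul a (ginv a) = gone.
Proof.
  rewrite <- (gmul_1l G (gmul a (ginv a))), <- (gmul_Vl G (ginv a)) at 1.
  rewrite <- gmul_assoc, (gmul_assoc G (ginv a) a), gmul_Vl, gmul_1l.
  apply gmul_Vl.
Qed.

Lemma gmul_1r a : gmul a gone = a.
Proof. now rewrite <- (gmul_Vl G a), gmul_assoc, gmul_Vr, gmul_1l. Qed.

Lemma gmulK a b : gmul (gmul a b) (ginv b) = a.
Proof. now rewrite <- gmul_assoc, gmul_Vr, gmul_1r. Qed.

Lemma gmulKV a b : gmul (gmul a (ginv b)) b = a.
Proof. now rewrite <- gmul_assoc, gmul_Vl, gmul_1r. Qed.

Lemma gmul_cancel_l a b c : gmul a b = gmul a c -> b = c.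
Proof.
  intros E. apply (f_equal (gmul (ginv a))) in E.
  now rewrite !gmul_assoc, gmul_Vl, !gmul_1l in E.
Qed.

Lemma gmul_cancel_r a b c : gmul b a = gmul c a -> b = c.
Proof.
  intros E. apply (f_equal (fun x => gmul x (ginv a))) in E.
  now rewrite !gmulK in E.
Qed.

Lemma ginv_unique a b : gmul a b = gone -> a = ginv b.
Proof. intros E. apply (gmul_cancel_r b). now rewrite E, gmul_Vl. Qed.

Lemma ginv_inv a : ginv (ginv a) = a.
Proof. symmetry. apply ginv_unique, gmul_Vr. Qed.

Lemma ginv_mul a b : ginv (gmul a b) = gmul (ginv b) (ginv a).
Proof. symmetry. apply ginv_unique. now rewrite gmul_assoc, gmulKV, gmul_Vl. Qed.

Lemma ginv_one : ginv (gone : G) = gone.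
Proof. symmetry. apply ginv_unique, gmul_1l. Qed.

End GroupLaws.

#[global] Hint Rewrite @gmul_assoc @gmul_1l @gmul_1r @gmul_Vl @gmul_Vr @gmulK @gmulKV
  @ginv_inv @ginv_mul @ginv_one : grp.
Ltac grp := autorewrite with grp; try reflexivity.

Section Powers.
Context {G : Group}.
Variable g : G.

Lemma gpow_comm n : gmul (gpow g n) g = gmul g (gpow g n).
Proof.
  induction n; simpl; [now rewrite gmul_1l, gmul_1r|].
  now rewrite <- gmul_assoc, IHn.
Qed.

Lemma gzpow_succ k : gzpow g (Z.succ k) = gmul g (gzpow g k).
Proof.
  destruct k as [|p|p].
  - simpl. now rewrite gmul_1r.
  - change (Z.succ (Z.pos p)) with (Z.pos p + 1)%Z. cbn [Z.add gzpow].
    rewrite Pos.add_1_r, Pos2Nat.inj_succ. reflexivity.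
  - destruct (Pos.eq_dec p 1) as [->|np].
    + change (Z.succ (-1)) with 0%Z. cbn [gzpow].
      change (Pos.to_nat 1) with 1%nat. simpl. now rewrite gmul_1r, gmul_Vr.
    + replace (Z.succ (Z.neg p)) with (Z.neg (Pos.pred p)) by lia.
      cbn [gzpow]. rewrite <- (Pos.succ_pred p np) at 2.
      rewrite Pos2Nat.inj_succ. cbn [gpow].
      rewrite <- gpow_comm. grp.
Qed.

Lemma gzpow_pred k : gzpow g (Z.pred k) = gmul (ginv g) (gzpow g k).
Proof.
  rewrite <- (Z.succ_pred k) at 2. rewrite gzpow_succ. grp.
Qed.

Lemma gzpow_add j k : gzpow g (j + k) = gmul (gzpow g j) (gzpow g k).
Proof.
  induction j using Z.peano_ind.
  - cbn [gzpow]. now rewrite gmul_1l.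
  - replace (Z.succ j + k)%Z with (Z.succ (j + k)) by lia.
    rewrite !gzpow_succ, IHj. grp.
  - replace (Z.pred j + k)%Z with (Z.pred (j + k)) by lia.
    rewrite !gzpow_pred, IHj. grp.
Qed.

Lemma gzpow_opp k : gzpow g (- k) = ginv (gzpow g k).
Proof.
  apply ginv_unique. rewrite <- gzpow_add.
  now replace (- k + k)%Z with 0%Z by lia.
Qed.

Definition cyclic (k : G) : Prop := exists n : Z, k = gzpow g n.

Lemma cyclic_subgroup : is_subgroup cyclic.
Proof.
  repeat split.
  - now exists 0%Z.
  - intros a b [m ->] [n ->]. exists (m + n)%Z. now rewrite gzpow_add.
  - intros a [m ->]. exists (- m)%Z. now rewrite gzpow_opp.
Qed.

Lemma gzpow_of_nat n : gzpow g (Z.of_nat n) = gpow g n.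
Proof.
  induction n; [reflexivity|].
  rewrite Nat2Z.inj_succ, gzpow_succ, IHn. reflexivity.
Qed.

Lemma cyclic_infinite :
  (forall n, (0 < n)%nat -> gpow g n <> gone) ->
  ~ exists l : list G, forall k, cyclic k -> In k l.
Proof.
  intros inf [l hl].
  assert (inj : forall i j, (i < j)%nat -> gpow g i <> gpow g j).
  { intros i j ij E. apply (inf (j - i)%nat); [lia|].
    rewrite <- !gzpow_of_nat in *. replace (Z.of_nat j) with (Z.of_nat i + Z.of_nat (j - i))%Z in E by lia.
    rewrite gzpow_add in E. apply (gmul_cancel_l (gzpow g (Z.of_nat i))).
    now rewrite gmul_1r. }
  set (L := map (gpow g) (seq 0 (S (length l)))).
  assert (nd : NoDup L).
  { apply Injective_map_NoDup; [|apply seq_NoDup].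
    intros i j E. destruct (Nat.lt_total i j) as [h|[h|h]]; auto;
      [destruct (inj _ _ h E)|destruct (inj _ _ h (eq_sym E))]. }
  assert (incl L l).
  { intros k hk. apply in_map_iff in hk as [n [<- _]]. apply hl.
    exists (Z.of_nat n). now rewrite gzpow_of_nat. }
  apply (NoDup_incl_length nd) in H. unfold L in H. rewrite length_map, length_seq in H. lia.
Qed.

End Powers.

(** * Finite lists and classes *)

Section Lists.
Context {T : Type}.
Implicit Types (l m : list T) (P : T -> Prop) (E : T -> T -> Prop).

Definition pfilter P : list T -> list T :=
  filter (fun a => if excluded_middle_informative (P a) then true else false).

Lemma in_pfilter P l a : In a (pfilter P l) <-> In a l /\ P a.
Proof.
  unfold pfilter. rewrite filter_In.
  destruct (excluded_middle_informative (P a)); intuition discriminate.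
Qed.

Lemma length_pfilter P l m :
  NoDup l -> (forall a, In a l -> P a -> In a m) ->
  (length l <= length (pfilter (fun a => ~ P a) l) + length m)%nat.
Proof.
  intros nd hm.
  assert (E : (length l = length (pfilter P l) + length (pfilter (fun a => ~ P a) l))%nat).
  { clear. induction l as [|a l IH]; [reflexivity|]. unfold pfilter in *; simpl.
    repeat destruct excluded_middle_informative; simpl; tauto || lia. }
  enough (length (pfilter P l) <= length m)%nat by lia.
  apply NoDup_incl_length; [now apply NoDup_filter|].
  intros a ha. apply in_pfilter in ha. now apply hm.
Qed.

(** Greedy selection: keep the head, discard the at most [k] elements equal or related to it, and
    recurse. *)
Lemma pairwise_inequiv_sublist E (k : nat) l :
  NoDup l ->
  (forall a, In a l -> exists m, (length m <= k)%nat /\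
     forall b, In b l -> b = a \/ E a b -> In b m) ->
  exists l', incl l' l /\ pairwise_inequiv E l' /\ (length l <= k * length l')%nat.
Proof.
  remember (length l) as n eqn:hn. revert l hn.
  induction n as [n IH] using lt_wf_ind. intros l hn nd hm.
  destruct l as [|a l].
  { exists nil. simpl in *. repeat split; auto; [intros x []|lia]. }
  destruct (hm a) as [m [lm hmm]]; [now left|].
  pose proof (length_pfilter (fun b => b = a \/ E a b) (a :: l) m nd
                (fun b hb hp => hmm b hb hp)) as hl.
  set (l1 := pfilter (fun b => ~ (b = a \/ E a b)) (a :: l)) in *.
  assert (i1 : incl l1 (a :: l)) by (intros b hb; apply in_pfilter in hb; tauto).
  assert (na : ~ In a l1) by (intros hb; apply in_pfilter in hb; tauto).
  assert (nd1 : NoDup l1) by now apply NoDup_filter.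
  assert (lt : (length l1 < n)%nat).
  { assert (NoDup (a :: l1)) as q by now constructor.
    assert (incl (a :: l1) (a :: l)) as q' by (intros b [->|hb]; [now left|auto]).
    pose proof (NoDup_incl_length q q'). simpl in *. lia. }
  destruct (IH _ lt l1 eq_refl nd1) as [l2 [i2 [p2 len2]]].
  { intros b hb. destruct (hm b (i1 _ hb)) as [m' [? ?]]. exists m'. auto. }
  exists (a :: l2). repeat split.
  - intros b [->|hb]; [now left|auto].
  - intros b hb. apply i2, in_pfilter in hb. tauto.
  - exact p2.
  - simpl length in *. rewrite Nat.mul_succ_r. lia.
Qed.

Lemma pairwise_inequiv_eq l : pairwise_inequiv eq l <-> NoDup l.
Proof.
  induction l as [|a l IH]; simpl; split; intros h; [constructor|exact I| |].
  - constructor; [|tauto]. intros ha. now apply (proj1 h a ha).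
  - inversion h; subst. split; [|tauto]. now intros b hb <-.
Qed.

Lemma pairwise_inequiv_mono E E' l :
  (forall a b, In a l -> In b l -> E' a b -> E a b) ->
  pairwise_inequiv E l -> pairwise_inequiv E' l.
Proof.
  induction l as [|a l IH]; simpl; [tauto|]. intros h [h1 h2]. split.
  - intros b hb e. now apply (h1 b hb), h; auto.
  - apply IH; auto.
Qed.

Lemma pairwise_inequiv_app E l m :
  pairwise_inequiv E l -> pairwise_inequiv E m ->
  (forall a b, In a l -> In b m -> ~ E a b) -> pairwise_inequiv E (l ++ m).
Proof.
  intros hl hm hlm. induction l as [|a l IH]; simpl in *; [assumption|]. split.
  - intros b hb. apply in_app_iff in hb as [hb|hb]; [now apply hl|]. apply hlm; auto.
  - apply IH; [tauto|auto].
Qed.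

Lemma pairwise_inequiv_map {S} (phi : S -> T) E (l : list S) :
  pairwise_inequiv (fun a b => E (phi a) (phi b)) l <-> pairwise_inequiv E (map phi l).
Proof.
  induction l as [|a l IH]; simpl; [tauto|]. rewrite IH. split; intros [h1 h2]; split; auto.
  - intros b hb. apply in_map_iff in hb as [c [<- hc]]. auto.
  - intros b hb. apply h1. now apply in_map.
Qed.

Lemma finite_enum P l : (forall a, P a -> In a l) ->
  exists m, NoDup m /\ forall a, In a m <-> P a.
Proof.
  intros hl.
  set (dec := fun a b : T => excluded_middle_informative (a = b)).
  exists (pfilter P (nodup dec l)). split.
  - apply NoDup_filter, NoDup_nodup.
  - intros a. rewrite in_pfilter, nodup_In. firstorder.
Qed.

Lemma infinite_large P : (~ exists l, forall a, P a -> In a l) ->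
  forall n : nat, exists l, NoDup l /\ (forall a, In a l -> P a) /\ length l = n.
Proof.
  intros inf. induction n as [|n [l [nd [hl len]]]].
  - exists nil. repeat split; [constructor|intros a []].
  - apply NNPP. intros no. apply inf. exists l. intros a ha. apply NNPP. intros na.
    apply no. exists (a :: l). repeat split; [now constructor| |simpl; lia].
    intros b [<-|hb]; auto.
Qed.

(** A candidate failing at [r0] fails at every larger threshold, so the answers at [Rmax r r0] come
    from the tail. *)
Lemma uniform_choice (Q : R -> T -> Prop) l :
  (forall r s c, r <= s -> Q s c -> Q r c) ->
  (forall r, exists c, In c l /\ Q r c) -> exists c, forall r, Q r c.
Proof.
  intros mono. induction l as [|a l IH]; intros h.
  - destruct (h 0) as [c [[] _]].
  - destruct (classic (forall r, Q r a)) as [q|q]; [now exists a|].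
    apply not_all_ex_not in q as [r0 q]. apply IH. intros r.
    destruct (h (Rmax r r0)) as [c [[<-|hc] hq]].
    + destruct q. revert hq. apply mono, Rmax_r.
    + exists c. split; auto. revert hq. apply mono, Rmax_l.
Qed.

Lemma list_max_bound (phi : T -> R) l : exists M, 0 <= M /\ forall a, In a l -> phi a <= M.
Proof.
  induction l as [|a l [M [hM IH]]].
  - exists 0. split; [lra|intros a []].
  - exists (Rmax M (phi a)). pose proof (Rmax_l M (phi a)). pose proof (Rmax_r M (phi a)).
    split; [lra|]. intros b [<-|hb]; [lra|]. specialize (IH b hb). lra.
Qed.

Lemma list_minimizer (phi : T -> R) P l : (exists a, In a l /\ P a) ->
  exists a, P a /\ forall b, In b l -> P b -> phi a <= phi b.
Proof.
  induction l as [|c l IH]; intros [a [ha pa]]; [destruct ha|].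
  destruct (classic (exists a, In a l /\ P a)) as [ex|nex].
  - destruct (IH ex) as [m [pm hm]].
    destruct (classic (P c)) as [pc|npc].
    + destruct (Rle_dec (phi m) (phi c)).
      * exists m. split; auto. intros b [<-|hb]; auto.
      * exists c. split; auto. intros b [<-|hb] pb; [lra|]. specialize (hm b hb pb). lra.
    + exists m. split; auto. intros b [<-|hb]; [tauto|auto].
  - exists a. split; auto. destruct ha as [<-|ha]; [|exfalso; eauto].
    intros b [<-|hb] pb; [lra|exfalso; eauto].
Qed.

End Lists.

(** * Growth rates *)

(** Lengths are integers, so an integer not exceeding the supremum is reached by some list, which is
    then cut to the exact length. Finite lists thus replace suprema from here on. *)
Lemma card_classes_ge {T : Type} (P : T -> Prop) (E : T -> T -> Prop) (n : nat) :
  Rbar_le (INR n) (card_classes P E) <->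
  exists l, (forall a, In a l -> P a) /\ pairwise_inequiv E l /\ length l = n.
Proof.
  unfold card_classes.
  match goal with |- context [Lub_Rbar ?S] => set (L := S) end.
  destruct (Lub_Rbar_correct L) as [ub lub]. split.
  - intros h.
    assert (ex : exists l, (forall a, In a l -> P a) /\ pairwise_inequiv E l /\
                           (n <= length l)%nat).
    { apply NNPP. intros no. destruct n as [|n].
      - apply no. exists nil. repeat split; [intros a []|simpl; lia].
      - assert (is_ub_Rbar L (INR n)) as u.
        { intros x [l [hl [pl ->]]]. simpl. apply le_INR.
          destruct (le_gt_dec (length l) n); [assumption|].
          destruct no. exists l. repeat split; auto. }
        assert (c : INR (S n) <= INR n) by exact (Rbar_le_trans _ _ _ h (lub _ u)).
        apply INR_le in c. lia. }
    destruct ex as [l [hl [pl len]]]. exists (firstn n l). repeat split.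
    + intros a ha. apply hl. rewrite <- (firstn_skipn n l). apply in_or_app. now left.
    + clear -pl. revert n. induction l as [|a l IH]; intros [|n]; simpl in *; auto.
      split; [|now apply IH]. intros b hb. apply pl.
      rewrite <- (firstn_skipn n l). apply in_or_app. now left.
    + rewrite length_firstn. lia.
  - intros [l [hl [pl <-]]]. apply ub. now exists l.
Qed.

Definition eventual_rate (N : R -> Rbar) (y : R) : Prop :=
  exists T, 0 < T /\ forall r n, T <= r -> Rbar_le (INR n) (N r) -> ln (INR n) <= y * r.

(** [ln 0 = 0] here, so that [n = 0] contributes the value [0] to the limsup. *)
Lemma ln_INR_0 : ln (INR 0) = 0.
Proof. unfold ln. simpl. destruct (Rlt_dec 0 0) as [c|]; [destruct (Rlt_irrefl 0 c)|reflexivity]. Qed.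

Lemma growth_rate_le (N : R -> Rbar) (s : R) :
  (forall r, Rbar_le 0 (N r)) ->
  (forall eps, 0 < eps -> eventual_rate N (s + eps)) -> Rbar_le (growth_rate N) s.
Proof.
  intros N0 h. unfold growth_rate.
  match goal with |- context [Glb_Rbar ?S] => set (Y := S) end.
  destruct (Glb_Rbar_correct Y) as [lb _].
  assert (key : forall eps, 0 < eps -> Rbar_le (Glb_Rbar Y) (s + eps)).
  { intros eps he. destruct (h eps he) as [T [hT hr]].
    set (Z := fun z => exists (r : R) (n : nat),
       T <= r /\ Rbar_le (Finite (INR n)) (N r) /\ z = ln (INR n) / r).
    destruct (Lub_Rbar_correct Z) as [ub lub].
    assert (l1 : Rbar_le (Lub_Rbar Z) (s + eps)).
    { apply lub. intros z [r [n [hTr [hn ->]]]]. simpl.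
      apply Rmult_le_reg_r with r; [lra|]. unfold Rdiv.
      rewrite Rmult_assoc, Rinv_l, Rmult_1_r by lra. now apply hr. }
    (* The value [n = 0] keeps the supremum above -oo; being also bounded above, it is a real, as
       the infimum requires. *)
    assert (l2 : Rbar_le 0 (Lub_Rbar Z)).
    { apply ub. exists T, 0%nat. rewrite ln_INR_0. repeat split; [lra|apply N0|field; lra]. }
    destruct (Lub_Rbar Z) as [y| |] eqn:ey; simpl in l1, l2; try tauto.
    apply Rbar_le_trans with (Finite y); [|exact l1].
    apply lb. exists T. split; auto. }
  destruct (Glb_Rbar Y) as [y| |]; simpl in *; auto.
  - apply Rnot_lt_le. intros c. specialize (key ((y - s) / 2)). lra.
  - apply (key 1); lra.
Qed.

Lemma growth_rate_lt (N : R -> Rbar) (s : R) :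
  (forall r, Rbar_le 0 (N r)) ->
  Rbar_lt (growth_rate N) s -> exists y, 0 <= y < s /\ eventual_rate N y.
Proof.
  intros N0 h. unfold growth_rate in h.
  match type of h with context [Glb_Rbar ?S] => set (Y := S) in h end.
  destruct (Glb_Rbar_correct Y) as [_ glb].
  assert (ex : exists y, Y y /\ y < s).
  { apply NNPP. intros no. apply (Rbar_lt_not_le _ _ h). apply glb.
    intros y hy. simpl. apply Rnot_lt_le. intros c. apply no. eauto. }
  destruct ex as [y [[T [hT hy]] ys]]. exists y.
  match type of hy with context [Lub_Rbar ?S] => set (Z := S) in hy end.
  destruct (Lub_Rbar_correct Z) as [ub _]. rewrite <- hy in ub.
  split; [split; [|exact ys]|exists T; split; [exact hT|]].
  - apply (ub 0). exists T, 0%nat. rewrite ln_INR_0. repeat split; [lra|apply N0|field; lra].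
  - intros r n hr hn.
    assert (z : ln (INR n) / r <= y) by (apply (ub (ln (INR n) / r)); now exists r, n).
    apply Rmult_le_compat_r with (r := r) in z; [|lra].
    unfold Rdiv in z. rewrite Rmult_assoc, Rinv_l, Rmult_1_r in z by lra. exact z.
Qed.

Lemma growth_rate_ge_0 (N : R -> Rbar) :
  (forall r, Rbar_le 0 (N r)) -> Rbar_le 0 (growth_rate N).
Proof.
  intros N0. apply Rbar_not_lt_le. intros h.
  destruct (growth_rate_lt N 0 N0 h) as [y [hy _]]. lra.
Qed.

(** A constant factor and a shift of the radius add a bounded term to the logarithm, negligible
    after division by [r]. *)
Lemma growth_rate_compare (N1 N2 : R -> Rbar) (K : nat) (c : R) :
  0 <= c -> (forall r, Rbar_le 0 (N1 r)) -> (forall r, Rbar_le 0 (N2 r)) ->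
  (forall r n, 0 < r -> Rbar_le (INR n) (N1 r) ->
     exists m : nat, Rbar_le (INR m) (N2 (r + c)) /\ (n <= K * m)%nat) ->
  Rbar_le (growth_rate N1) (growth_rate N2).
Proof.
  intros hc p1 p2 h.
  enough (key : forall s, Rbar_lt (growth_rate N2) (Finite s) -> Rbar_le (growth_rate N1) (Finite s)).
  { pose proof (growth_rate_ge_0 N2 p2) as g0.
    destruct (growth_rate N2) as [y| |]; [| |destruct g0].
    - destruct (growth_rate N1) as [x| |]; simpl; auto.
      + apply Rnot_lt_le. intros xy. specialize (key ((x + y) / 2)). simpl in key. lra.
      + specialize (key (y + 1)). simpl in key. apply key. lra.
    - now destruct (growth_rate N1). }
  intros s hs. destruct (growth_rate_lt N2 s p2 hs) as [y [hy [T [hT hr]]]].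
  apply growth_rate_le; [exact p1|]. intros eps heps.
  set (B := ln (INR (S K)) + y * c).
  assert (lK : 0 <= ln (INR (S K))).
  { rewrite <- ln_1. apply Rcomplements.ln_le; [lra|]. rewrite S_INR. pose proof (pos_INR K). lra. }
  assert (hB : 0 <= B) by (unfold B; nra).
  exists (T + B / eps).
  assert (0 <= B / eps) by (apply Rcomplements.Rdiv_le_0_compat; lra).
  split; [lra|]. intros r n hrT hn.
  assert (Br : B <= eps * r).
  { replace B with (eps * (B / eps)) by (field; lra). apply Rmult_le_compat_l; lra. }
  destruct n as [|n]; [rewrite ln_INR_0; nra|].
  destruct (h r (S n)) as [m [hm nm]]; [lra|exact hn|].
  destruct m as [|m]; [lia|].
  specialize (hr (r + c) (S m) ltac:(lra) hm).
  assert (ln (INR (S n)) <= ln (INR (S K)) + ln (INR (S m))).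
  { rewrite <- ln_mult; try (apply lt_0_INR; lia).
    apply Rcomplements.ln_le; [apply lt_0_INR; lia|]. rewrite <- mult_INR. apply le_INR. nia. }
  unfold B in Br. nra.
Qed.

Lemma card_classes_pos {T : Type} (P : T -> Prop) (E : T -> T -> Prop) :
  Rbar_le 0 (card_classes P E).
Proof.
  change (Rbar_le (INR 0) (card_classes P E)). apply card_classes_ge.
  exists nil. repeat split. intros a [].
Qed.

(** * Growth from ping-pong *)

Lemma exp_monotone x y : x <= y -> exp x <= exp y.
Proof. intros [h| ->]; [now apply Rlt_le, exp_increasing|apply Rle_refl]. Qed.

Lemma exp_pow_INR x n : exp x ^ n = exp (INR n * x).
Proof.
  induction n as [|n IH]; [simpl; now rewrite Rmult_0_l, exp_0|].
  rewrite S_INR. simpl. rewrite IH, <- exp_plus. f_equal. ring.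
Qed.

Section Growth.
Context {G : Group} {X : MetricSpace} (act : G -> X -> X).
Hypothesis hiso : isometric_action act.

Lemma act_inv_r g x : act g (act (ginv g) x) = x.
Proof. destruct hiso as [h1 [hm _]]. now rewrite <- hm, gmul_Vr. Qed.

Lemma dist_act_inv g x y : dist (act (ginv g) x) y = dist x (act g y).
Proof. destruct hiso as [_ [_ hd]]. now rewrite <- (hd g), act_inv_r. Qed.

Lemma dist_ge_0 (x y : X) : 0 <= dist x y.
Proof. pose proof (dist_tri X x y x). rewrite (dist_sym X y x), dist_refl in H. lra. Qed.

Definition len (o : X) (g : G) : R := dist o (act g o).

Lemma len_mul o g h : len o (gmul g h) <= len o g + len o h.
Proof.
  unfold len. destruct hiso as [_ [hm hd]]. rewrite hm.
  rewrite <- (hd g o (act h o)). apply dist_tri.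
Qed.

Lemma len_inv o g : len o (ginv g) = len o g.
Proof. unfold len. now rewrite dist_sym, dist_act_inv. Qed.

Lemma len_base o o' g : len o' g <= len o g + 2 * dist o o'.
Proof.
  unfold len. destruct hiso as [_ [_ hd]].
  pose proof (dist_tri X o' o (act g o')). pose proof (dist_tri X o (act g o) (act g o')).
  rewrite hd in H0. rewrite (dist_sym X o' o) in H. lra.
Qed.

Lemma omega_sub_base H o o' : Rbar_le (omega_sub act H o) (omega_sub act H o').
Proof.
  pose proof (dist_ge_0 o o').
  apply growth_rate_compare with (K := 1%nat) (c := 2 * dist o o');
    try (intros; apply card_classes_pos); [lra|].
  intros r n hr hn. exists n. split; [|lia].
  apply card_classes_ge in hn as [l [hl [pl <-]]]. apply card_classes_ge. exists l.
  repeat split; auto; [|apply hl, H1].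
  destruct (hl a H1) as [ha _]. unfold ballG in *. pose proof (len_base o o' a). unfold len in *. lra.
Qed.

Lemma omega_grp_base o o' : Rbar_le (omega_grp act o) (omega_grp act o').
Proof.
  pose proof (dist_ge_0 o o').
  apply growth_rate_compare with (K := 1%nat) (c := 2 * dist o o');
    try (intros; apply card_classes_pos); [lra|].
  intros r n hr hn. exists n. split; [|lia].
  apply card_classes_ge in hn as [l [hl [pl <-]]]. apply card_classes_ge. exists l.
  repeat split; auto. intros a ha. specialize (hl a ha).
  unfold ballG in *. pose proof (len_base o o' a). unfold len in *. lra.
Qed.

Lemma omega_left_right_cosets H o : omega_left_cosets act H o = omega_right_cosets act H o.
Proof.
  assert (inv : forall (E E' : G -> G -> Prop) r n,
    (forall a b, E' (ginv a) (ginv b) <-> E a b) ->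
    Rbar_le (INR n) (card_classes (ballG act o r) E) ->
    Rbar_le (INR n) (card_classes (ballG act o r) E')).
  { intros E E' r n hE hn. apply card_classes_ge in hn as [l [hl [pl <-]]].
    apply card_classes_ge. exists (map ginv l). repeat split; [| |apply length_map].
    - intros a ha. apply in_map_iff in ha as [b [<- hb]].
      unfold ballG. change (len o (ginv b) <= r). rewrite len_inv. now apply hl.
    - apply (proj1 (pairwise_inequiv_map ginv E' l)). revert pl. apply pairwise_inequiv_mono.
      intros a b _ _. apply hE. }
  apply Rbar_le_antisym; apply growth_rate_compare with (K := 1%nat) (c := 0);
    try (intros; apply card_classes_pos); try lra;
    intros r n _ hn; exists n; (split; [|lia]); rewrite Rplus_0_r; revert hn; apply inv;
    intros a b; now rewrite ginv_inv.
Qed.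

(** [Far] stands for the elements whose orbit point projects far from the base point of a
    contracting axis transverse to [H]. *)
Definition ping_pong (H : G -> Prop) (Far : G -> Prop) (f : G) (Phi : list G) : Prop :=
  (forall h y, H h -> Far y -> Far (gmul h y) -> In h Phi) /\
  (forall y, ~ Far y -> Far (gmul f y)).

Section PingPong.
Variables (H : G -> Prop) (Far : G -> Prop) (f : G) (Phi : list G).
Hypothesis hH : is_subgroup H.
Hypothesis hpp : ping_pong H Far f Phi.

Lemma omega_right_cosets_eq o : omega_right_cosets act H o = omega_grp act o.
Proof.
  destruct hpp as [k1 k2]. apply Rbar_le_antisym.
  - apply growth_rate_compare with (K := 1%nat) (c := 0);
      try (intros; apply card_classes_pos); [lra|].
    intros r n _ hn. exists n. split; [|lia]. rewrite Rplus_0_r.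
    apply card_classes_ge in hn as [l [hl [pl <-]]]. apply card_classes_ge. exists l.
    repeat split; auto. revert pl. apply pairwise_inequiv_mono.
    intros a b _ _ <-. rewrite gmul_Vr. apply hH.
  (* All values of [phi] lie in [Far], where [Phi] controls [H], and each has at most two
     preimages. *)
  - set (phi := fun g => if excluded_middle_informative (Far g) then g else gmul f g).
    assert (phiF : forall g, Far (phi g)).
    { intros g. unfold phi. destruct excluded_middle_informative; auto. }
    assert (phiE : forall g, phi g = g \/ phi g = gmul f g).
    { intros g. unfold phi. destruct excluded_middle_informative; auto. }
    apply growth_rate_compare with (K := (2 * length Phi)%nat) (c := len o f);
      try (intros; apply card_classes_pos); [apply dist_ge_0|].
    intros r n _ hn. apply card_classes_ge in hn as [l [hl [pl <-]]].
    apply pairwise_inequiv_eq in pl.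
    destruct (pairwise_inequiv_sublist (fun a b => H (gmul (phi a) (ginv (phi b))))
                (2 * length Phi) l pl) as [l' [il' [pl' len']]].
    { intros a _.
      (* The quotient [p] maps [phi b] to [phi a], both in [Far], so it lies in [Phi]; undoing [phi]
         doubles the list. *)
      exists (map (fun h => gmul (ginv h) (phi a)) Phi ++
              map (fun h => gmul (ginv f) (gmul (ginv h) (phi a))) Phi).
      split; [rewrite length_app, !length_map; lia|]. intros b _ hb.
      set (p := gmul (phi a) (ginv (phi b))) in *.
      assert (hp : H p) by (destruct hb as [->|hb]; [unfold p; rewrite gmul_Vr; apply hH|exact hb]).
      assert (hin : In p Phi).
      { apply (k1 p (phi b)); auto. unfold p. rewrite gmulKV. apply phiF. }
      assert (eb : gmul (ginv p) (phi a) = phi b) by (unfold p; grp).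
      apply in_or_app. destruct (phiE b) as [e|e]; rewrite e in eb; [left|right];
        apply in_map_iff; exists p; (split; [|exact hin]); rewrite eb; grp. }
    exists (length l'). split; [|exact len'].
    apply card_classes_ge. exists (map phi l'). repeat split; [| |apply length_map].
    + intros a ha. apply in_map_iff in ha as [b [<- hb]]. specialize (hl b (il' b hb)).
      unfold ballG in *. change (len o b <= r) in hl. change (len o (phi b) <= r + len o f).
      pose proof (len_mul o f b). pose proof (dist_ge_0 o (act f o)).
      destruct (phiE b) as [e|e]; rewrite e; unfold len in *; lra.
    + now apply (proj1 (pairwise_inequiv_map phi (fun a b => H (gmul a (ginv b))) l')).
Qed.

(** * Poincare series and growth exponents *)

Variable o : X.

(** A partial sum of the Poincare series at exponent [s]. *)
Definition weight (s : R) (l : list G) : R :=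
  fold_right (fun g acc => exp (- s * len o g) + acc) 0 l.

Lemma weight_app s l m : weight s (l ++ m) = weight s l + weight s m.
Proof. induction l as [|a l IH]; simpl; [lra|]. rewrite IH. lra. Qed.

Lemma weight_ge_0 s l : 0 <= weight s l.
Proof. induction l as [|a l IH]; simpl; [lra|]. pose proof (exp_pos (- s * len o a)). lra. Qed.

Lemma weight_ge s L l : 0 <= s -> (forall g, In g l -> len o g <= L) ->
  INR (length l) * exp (- s * L) <= weight s l.
Proof.
  intros hs. induction l as [|a l IH]; intros hl; [simpl; lra|].
  specialize (IH (fun g hg => hl g (or_intror hg))).
  change (length (a :: l)) with (S (length l)). rewrite S_INR. simpl.
  assert (exp (- s * L) <= exp (- s * len o a)).
  { apply exp_monotone. specialize (hl a (or_introl eq_refl)). nra. }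
  lra.
Qed.

Lemma weight_le s L l : 0 <= s -> (forall g, In g l -> L <= len o g) ->
  weight s l <= INR (length l) * exp (- s * L).
Proof.
  intros hs. induction l as [|a l IH]; intros hl; [simpl; lra|].
  specialize (IH (fun g hg => hl g (or_intror hg))).
  change (length (a :: l)) with (S (length l)). rewrite S_INR. simpl.
  assert (exp (- s * len o a) <= exp (- s * L)).
  { apply exp_monotone. specialize (hl a (or_introl eq_refl)). nra. }
  lra.
Qed.

(** Raising the exponent costs a bounded factor on a finite set, which lets a large sum at the
    exponent of [H] be used slightly above it. *)
Lemma weight_shift s e L l : 0 <= e -> (forall g, In g l -> len o g <= L) ->
  exp (- e * L) * weight s l <= weight (s + e) l.
Proof.
  intros he. induction l as [|a l IH]; intros hl; simpl; [lra|].
  specialize (IH (fun g hg => hl g (or_intror hg))).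
  assert (exp (- e * L) * exp (- s * len o a) <= exp (- (s + e) * len o a)).
  { rewrite <- exp_plus. apply exp_monotone. specialize (hl a (or_introl eq_refl)). nra. }
  lra.
Qed.

Lemma weight_filter s P l :
  weight s l = weight s (pfilter P l) + weight s (pfilter (fun a => ~ P a) l).
Proof.
  unfold pfilter. induction l as [|a l IH]; simpl; [lra|]. rewrite IH.
  repeat destruct excluded_middle_informative; simpl; tauto || lra.
Qed.

(** The Poincare series converges above the growth exponent: cut into annuli of width one, it is
    dominated by a geometric series. *)
Lemma weight_bounded y s : 0 <= y < s ->
  eventual_rate (fun r => card_classes (ballG act o r) eq) y ->
  exists C, forall l, NoDup l -> weight s l <= C.
Proof.
  intros hy [T [hT hr]].
  assert (cnt : forall l r, T <= r -> NoDup l -> (forall g, In g l -> len o g <= r) ->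
            INR (length l) <= exp (y * r)).
  { intros l r hTr nd hl. destruct l as [|a l]; [simpl; apply Rlt_le, exp_pos|].
    rewrite <- (exp_ln (INR (length (a :: l)))) by (apply lt_0_INR; simpl; lia).
    apply exp_monotone, hr; auto. apply card_classes_ge. exists (a :: l).
    split; [exact hl|split; [now apply pairwise_inequiv_eq|reflexivity]]. }
  set (rho := exp (y - s)).
  assert (hrho : 0 < rho < 1).
  { split; [apply exp_pos|]. rewrite <- exp_0. apply exp_increasing. lra. }
  (* [C0] bounds the ball of radius [T], whose terms are at most 1; [D * rho ^ n] is the annulus
     bound [exp (y (T + n + 1)) exp (- s (T + n))]. *)
  set (D := exp (y + (y - s) * T)). set (C0 := exp (y * T)).
  assert (key : forall n l, NoDup l -> (forall g, In g l -> len o g <= T + INR n) ->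
            weight s l <= C0 + D * ((1 - rho ^ n) / (1 - rho))).
  { induction n as [|n IH]; intros l nd hl.
    - assert (h0 : weight s l <= INR (length l) * exp (- s * 0)).
      { apply weight_le; [lra|]. intros. apply dist_ge_0. }
      replace (- s * 0) with 0 in h0 by ring. rewrite exp_0, Rmult_1_r in h0.
      simpl. unfold C0. simpl in hl. rewrite Rplus_0_r in hl.
      specialize (cnt l T ltac:(lra) nd hl). lra.
    - rewrite (weight_filter s (fun g => len o g <= T + INR n)).
      assert (h1 : weight s (pfilter (fun g => len o g <= T + INR n) l) <=
                   C0 + D * ((1 - rho ^ n) / (1 - rho))).
      { apply IH; [now apply NoDup_filter|]. intros g hg. now apply in_pfilter in hg. }
      set (l2 := pfilter (fun g => ~ len o g <= T + INR n) l).
      assert (h2 : weight s l2 <= D * rho ^ n).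
      { apply Rle_trans with (INR (length l2) * exp (- s * (T + INR n))).
        - apply weight_le; [lra|]. intros g hg. apply in_pfilter in hg. lra.
        - apply Rle_trans with (exp (y * (T + INR (S n))) * exp (- s * (T + INR n))).
          + apply Rmult_le_compat_r; [apply Rlt_le, exp_pos|]. apply cnt.
            * pose proof (pos_INR (S n)). lra.
            * now apply NoDup_filter.
            * intros g hg. apply in_pfilter in hg. now apply hl.
          + right. unfold D, rho. rewrite exp_pow_INR, <- !exp_plus, S_INR. f_equal. ring. }
      replace (D * ((1 - rho ^ S n) / (1 - rho)))
        with (D * ((1 - rho ^ n) / (1 - rho)) + D * rho ^ n) by (simpl; field; lra).
      lra. }
  exists (C0 + D / (1 - rho)). intros l nd.
  destruct (list_max_bound (len o) l) as [M [hM hl]].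
  destruct (nfloor_ex M hM) as [n [_ hn]].
  apply Rle_trans with (C0 + D * ((1 - rho ^ S n) / (1 - rho))).
  - apply key; auto. intros g hg. specialize (hl g hg). rewrite S_INR. lra.
  - apply Rplus_le_compat_l, Rmult_le_compat_l; [apply Rlt_le, exp_pos|].
    unfold Rdiv. rewrite <- (Rmult_1_l (/ (1 - rho))) at 2.
    apply Rmult_le_compat_r; [apply Rlt_le, Rinv_0_lt_compat; lra|].
    pose proof (pow_le rho (S n)). lra.
Qed.

(** The translates [a Far] and [b Far] meet. *)
Definition ping_rel (a b : G) : Prop :=
  exists y z, Far y /\ Far z /\ gmul a y = gmul b z.

Lemma ping_rel_sym a b : ping_rel a b -> ping_rel b a.
Proof. intros [y [z [? [? ?]]]]. now exists z, y. Qed.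

Lemma ping_rel_finite a b : H a -> H b -> ping_rel a b -> exists p, In p Phi /\ b = gmul a p.
Proof.
  intros ha hb [y [z [fy [fz e]]]]. exists (gmul (ginv a) b). split; [|grp].
  destruct hH as [_ [hm hi]]. apply (proj1 hpp _ z); auto.
  rewrite <- gmul_assoc, <- e. autorewrite with grp. exact fy.
Qed.

Fixpoint words (e : G) (F : list G) (n : nat) : list G :=
  match n with
  | O => e :: nil
  | S n => flat_map (fun h => map (fun v => gmul f (gmul h v)) (words e F n)) F
  end.

(** Listing [gone] makes each [h Far] disjoint from [Far]: a letter takes a word out of [Far] and
    [f] brings it back. *)
Lemma words_far e F n : Far e -> pairwise_inequiv ping_rel (F ++ gone :: nil) ->
  forall v, In v (words e F n) -> Far v.
Proof.
  intros he hF. induction n as [|n IH]; intros v hv; simpl in hv.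
  - now destruct hv as [<-|[]].
  - apply in_flat_map in hv as [h [hh hv]]. apply in_map_iff in hv as [w [<- hw]].
    apply hpp. intros c. specialize (IH w hw).
    assert (r : ping_rel h gone) by (exists w, (gmul h w); now rewrite gmul_1l).
    clear -hF hh r. induction F as [|a F IHF]; [destruct hh|]. destruct hF as [h1 h2].
    destruct hh as [->|hh]; [|now apply IHF]. apply (h1 gone); auto.
    apply in_or_app; right; now left.
Qed.

(** After cancelling [f], words with different first letters lie in disjoint translates of [Far]. *)
Lemma words_NoDup e F n : Far e -> pairwise_inequiv ping_rel (F ++ gone :: nil) ->
  NoDup (words e F n).
Proof.
  intros he hF. induction n as [|n IH]; simpl.
  - constructor; [intros []|constructor].
  - pose proof (words_far e F n he hF) as hw. revert hF IH hw.
    generalize (words e F n) as W. intros W hF nd hw.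
    induction F as [|a F IHF]; simpl; [constructor|]. destruct hF as [h1 h2].
    apply NoDup_app; [|now apply IHF|].
    + apply Injective_map_NoDup; auto. intros v w E.
      now apply gmul_cancel_l, gmul_cancel_l in E.
    + intros x hx hx'. apply in_map_iff in hx as [v [<- hv]].
      apply in_flat_map in hx' as [h [hh hx']]. apply in_map_iff in hx' as [w [E hw']].
      apply gmul_cancel_l in E. apply (h1 h); [apply in_or_app; now left|].
      exists v, w. auto.
Qed.

(** [len] is subadditive, so the terms are supermultiplicative and the sum over words dominates a
    product. *)
Lemma weight_words s e F n : 0 <= s ->
  exp (- s * len o f) * weight s F * weight s (words e F n) <= weight s (words e F (S n)).
Proof.
  intros hs. simpl. generalize (words e F n) as W. intros W.
  induction F as [|a F IHF]; simpl; [lra|]. rewrite weight_app.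
  enough (exp (- s * len o f) * exp (- s * len o a) * weight s W <=
          weight s (map (fun v => gmul f (gmul a v)) W)) by lra.
  clear -hiso hs. induction W as [|v W IH]; simpl; [lra|].
  enough (exp (- s * len o f) * exp (- s * len o a) * exp (- s * len o v) <=
          exp (- s * len o (gmul f (gmul a v)))) by lra.
  rewrite <- !exp_plus. apply exp_monotone.
  pose proof (len_mul o f (gmul a v)). pose proof (len_mul o a v). nra.
Qed.

(** The words are distinct and their total weight is unbounded in [n], so the Poincare series
    diverges at [s]. *)
Lemma omega_grp_ge s F : 0 <= s -> pairwise_inequiv ping_rel (F ++ gone :: nil) ->
  2 <= exp (- s * len o f) * weight s F -> Rbar_le s (omega_grp act o).
Proof.
  intros hs hF hq. apply Rbar_not_lt_le. intros c.
  apply growth_rate_lt in c as [y [hy hev]]; [|intros; apply card_classes_pos].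
  destruct (weight_bounded y s hy hev) as [C hC].
  assert (exists e, Far e) as [e he].
  { destruct (classic (Far gone)); [now exists gone|]. exists (gmul f gone). now apply hpp. }
  set (w0 := exp (- s * len o e)). assert (p0 : 0 < w0) by apply exp_pos.
  (* The weight at least doubles with each letter; linear growth is enough. *)
  assert (key : forall n, (1 + INR n) * w0 <= weight s (words e F n)).
  { induction n as [|n IH]; [simpl; fold w0; lra|].
    pose proof (weight_words s e F n hs) as h. rewrite S_INR. pose proof (pos_INR n).
    assert (0 <= (exp (- s * len o f) * weight s F - 2) * weight s (words e F n)).
    { apply Rmult_le_pos; [lra|apply weight_ge_0]. }
    nra. }
  destruct (nfloor_ex (Rmax 0 (C / w0)) (Rmax_l _ _)) as [n [_ hn]].
  specialize (key n). specialize (hC _ (words_NoDup e F n he hF)).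
  pose proof (Rmax_r 0 (C / w0)).
  assert (C < (1 + INR n) * w0); [|lra].
  replace C with (C / w0 * w0) by (field; lra). apply Rmult_lt_compat_r; lra.
Qed.

(** * Ball counts in a quasi-convex subgroup and the strict inequality *)

Variable eta : R.
Hypothesis heta : 0 <= eta.
Hypothesis split_H : forall h r t, H h -> 0 <= r -> 0 <= t -> len o h <= r + t ->
  exists k, H k /\ len o k <= r + eta /\ len o (gmul (ginv k) h) <= t + eta.
Hypothesis fin_ball : forall r, exists l, NoDup l /\ forall g, In g l <-> H g /\ len o g <= r.

Let ball (r : R) : list G := proj1_sig (constructive_indefinite_description _ (fin_ball r)).

Let ball_NoDup r : NoDup (ball r).
Proof. unfold ball. destruct constructive_indefinite_description as [l [h1 h2]]. exact h1. Qed.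

Let ball_in r g : In g (ball r) <-> H g /\ len o g <= r.
Proof. unfold ball. destruct constructive_indefinite_description as [l [h1 h2]]. simpl. apply h2. Qed.

(** The shift by [2 * eta] absorbs the loss in splitting: [r + t + 2 eta] is cut as
    [(r + eta) + (t + eta)], and each factor gains another [eta]. *)
Let u (r : R) : nat := length (ball (r + 2 * eta)).

Let u_pos r : 0 <= r -> (1 <= u r)%nat.
Proof.
  intros hr. assert (i : In gone (ball (r + 2 * eta))).
  { apply ball_in. split; [apply hH|]. unfold len. destruct hiso as [h1 _].
    rewrite h1, dist_refl. lra. }
  unfold u. destruct (ball (r + 2 * eta)); [destruct i|simpl; lia].
Qed.

Let u_submult r t : 0 <= r -> 0 <= t -> (u (r + t) <= u r * u t)%nat.
Proof.
  intros hr ht. unfold u. rewrite <- length_prod.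
  rewrite <- (length_map (fun p => gmul (fst p) (snd p))).
  apply NoDup_incl_length; [apply ball_NoDup|]. intros g hg. apply ball_in in hg as [hg lg].
  destruct (split_H g (r + eta) (t + eta)) as [k [hk [l1 l2]]]; auto; try lra.
  apply in_map_iff. exists (k, gmul (ginv k) g). split; [simpl; grp|].
  apply in_prod; apply ball_in; split; auto; try lra. apply hH; auto. now apply hH.
Qed.

Let u_pow r n : 0 <= r -> (u (INR (S n) * r) <= u r ^ S n)%nat.
Proof.
  intros hr. induction n as [|n IH].
  - simpl. rewrite Rmult_1_l. lia.
  - replace (INR (S (S n)) * r) with (r + INR (S n) * r) by (rewrite (S_INR (S n)); ring).
    apply Nat.le_trans with (1 := u_submult r (INR (S n) * r) hr ltac:(apply Rmult_le_pos; [apply pos_INR|lra])).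
    change (u r ^ S (S n))%nat with (u r * u r ^ S n)%nat. now apply Nat.mul_le_mono_l.
Qed.

(** Fekete: the exponent of a submultiplicative sequence is an infimum. *)
Lemma omega_sub_le r : 0 < r -> Rbar_le (omega_sub act H o) (ln (INR (u r)) / r).
Proof.
  intros hr. assert (pu := u_pos r ltac:(lra)).
  assert (lu : 0 <= ln (INR (u r))).
  { rewrite <- ln_1. apply Rcomplements.ln_le; [lra|]. now apply (le_INR 1). }
  apply growth_rate_le; [intros; apply card_classes_pos|]. intros eps he.
  set (B := ln (INR (u r))) in *.
  exists (1 + B / eps). assert (0 <= B / eps) by (apply Rcomplements.Rdiv_le_0_compat; lra).
  split; [lra|]. intros t n ht hn.
  assert (Br : B <= eps * t).
  { replace B with (eps * (B / eps)) by (field; lra). apply Rmult_le_compat_l; lra. }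
  assert (0 <= B / r) by (apply Rcomplements.Rdiv_le_0_compat; lra).
  destruct n as [|n]; [rewrite ln_INR_0; nra|].
  destruct (nfloor_ex (t / r)) as [k [hk1 hk2]]; [apply Rcomplements.Rdiv_le_0_compat; lra|].
  assert (tk : t <= INR (S k) * r).
  { rewrite S_INR. replace t with (t / r * r) by (field; lra). apply Rmult_le_compat_r; lra. }
  assert (nle : (S n <= u r ^ S k)%nat).
  { apply card_classes_ge in hn as [l [hl [pl ll]]]. rewrite <- ll.
    apply Nat.le_trans with (2 := u_pow r k ltac:(lra)). apply pairwise_inequiv_eq in pl.
    apply NoDup_incl_length; auto. intros g hg. apply hl in hg as [hg1 hg2]. apply ball_in.
    unfold ballG in hg1. split; [exact hg2|]. unfold len. lra. }
  assert (lnn : ln (INR (S n)) <= INR (S k) * B).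
  { unfold B. rewrite <- ln_pow by (apply lt_0_INR; lia).
    apply Rcomplements.ln_le; [apply lt_0_INR; lia|]. rewrite <- pow_INR. now apply le_INR. }
  rewrite (S_INR k) in lnn.
  assert (kB : INR k * B <= t / r * B) by (apply Rmult_le_compat_r; lra).
  replace (t / r * B) with (B / r * t) in kB by (field; lra). lra.
Qed.

Hypothesis H_inf : ~ exists l, forall h, H h -> In h l.

(** Letters of [H] are gathered in rounds, each adding weight at least [c] at the exponent [om] of
    [H], until the words in them diverge even at [om + e]. *)
Lemma omega_sub_lt_grp_of_split : Rbar_lt (omega_sub act H o) (omega_grp act o).
Proof.
  pose proof (growth_rate_ge_0 (fun r => card_classes (fun g => ballG act o r g /\ H g) eq)
     (fun r => card_classes_pos _ _)) as ge0.
  fold (omega_sub act H o) in ge0.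
  destruct (omega_sub act H o) as [om| |] eqn:eom;
    [|specialize (omega_sub_le 1 ltac:(lra)); now rewrite eom|destruct ge0].
  simpl in ge0.
  assert (lower : forall r, 0 < r -> exp (om * r) <= INR (u r)).
  { intros r hr. pose proof (omega_sub_le r hr) as h. rewrite eom in h. simpl in h.
    rewrite <- (exp_ln (INR (u r))) by (apply lt_0_INR; apply u_pos; lra).
    apply exp_monotone. replace (ln (INR (u r))) with (ln (INR (u r)) / r * r) by (field; lra).
    apply Rmult_le_compat_r; lra. }
  (* [K] counts an element [a] with its possible relatives [a p], [p] in [Phi]. At least half of a
     large ball avoids the earlier letters and one in [K] of that half is kept, whence [c]. *)
  set (K := S (length Phi)).
  set (c := exp (- om * (2 * eta)) / (2 * INR K)).
  assert (pK : 0 < INR K) by (apply lt_0_INR; unfold K; lia).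
  assert (pc : 0 < c) by (apply Rdiv_lt_0_compat; [apply exp_pos|lra]).
  assert (build : forall j, exists F, (forall h, In h F -> H h) /\
     pairwise_inequiv ping_rel (F ++ gone :: nil) /\ INR j * c <= weight om F).
  { induction j as [|j [F [hF [pF wF]]]].
    { exists nil. simpl. repeat split; [intros h []|intros b []|lra]. }
    set (F1 := F ++ gone :: nil) in *.
    assert (hF1 : forall h, In h F1 -> H h).
    { intros h hh. apply in_app_iff in hh as [hh|[<-|[]]]; [auto|apply hH]. }
    (* [M] contains every element of [H] related to an earlier letter or to [gone]; a ball with at
       least [2 |M|] elements exists because [H] is infinite. *)
    set (M := flat_map (fun b => map (gmul b) Phi) F1).
    destruct (infinite_large H H_inf (2 * length M)) as [l0 [nd0 [hl0 len0]]].
    destruct (list_max_bound (len o) l0) as [L0 [pL0 hL0]].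
    set (L := L0 + 1 + 2 * eta).
    assert (big : (2 * length M <= length (ball L))%nat).
    { rewrite <- len0. apply NoDup_incl_length; auto. intros h hh. apply ball_in.
      split; auto. specialize (hL0 h hh). unfold L. lra. }
    assert (fl := length_pfilter (fun a => exists b, In b F1 /\ ping_rel a b) (ball L) M
       (ball_NoDup L)).
    set (l1 := pfilter (fun a => ~ exists b, In b F1 /\ ping_rel a b) (ball L)) in *.
    assert (fl' : (length (ball L) <= length l1 + length M)%nat).
    { apply fl. intros a ha [b [hb r]]. apply ball_in in ha.
      destruct (ping_rel_finite b a) as [p [hp ->]]; [auto|tauto|now apply ping_rel_sym|].
      apply in_flat_map. exists b. split; auto. now apply in_map. }
    clear fl.
    destruct (pairwise_inequiv_sublist ping_rel K l1) as [l2 [i2 [p2 len2]]].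
    { now apply NoDup_filter. }
    { intros a ha. exists (a :: map (gmul a) Phi). split; [simpl; rewrite length_map; unfold K; lia|].
      intros b hb [->|r]; [now left|]. right.
      apply in_pfilter in ha as [ha _]. apply in_pfilter in hb as [hb _].
      apply ball_in in ha. apply ball_in in hb.
      destruct (ping_rel_finite a b) as [p [hp ->]]; try tauto. now apply in_map. }
    exists (l2 ++ F). repeat split.
    - intros h hh. apply in_app_iff in hh as [hh|hh]; auto.
      apply i2, in_pfilter in hh as [hh _]. now apply ball_in in hh.
    - rewrite <- app_assoc. apply pairwise_inequiv_app; auto. intros a b ha hb r.
      apply i2, in_pfilter in ha as [_ ha]. apply ha. now exists b.
    - rewrite weight_app, S_INR. enough (c <= weight om l2) by lra.
      apply Rle_trans with (INR (length l2) * exp (- om * L)).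
      2:{ apply weight_ge; auto. intros g hg. apply i2, in_pfilter in hg as [hg _].
          now apply ball_in in hg. }
      assert (i : (length (ball L) <= 2 * (K * length l2))%nat) by lia.
      apply le_INR in i. rewrite !mult_INR in i. change (INR 2) with 2 in i.
      specialize (lower (L0 + 1) ltac:(lra)). unfold u in lower. fold L in lower.
      assert (exp (om * (L0 + 1)) * exp (- om * L) <= 2 * (INR K * INR (length l2)) * exp (- om * L)).
      { apply Rmult_le_compat_r; [apply Rlt_le, exp_pos|lra]. }
      rewrite <- exp_plus in H0.
      replace (om * (L0 + 1) + - om * L) with (- om * (2 * eta)) in H0 by (unfold L; ring).
      unfold c. apply Rmult_le_reg_r with (2 * INR K); [lra|].
      unfold Rdiv. rewrite Rmult_assoc, Rinv_l by lra. lra. }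
  (* Twice what [omega_grp_ge] needs at [om]; the spare factor 2 pays for raising the exponent. *)
  set (Q := 4 * exp (om * len o f)).
  assert (pQ : 0 < Q) by (pose proof (exp_pos (om * len o f)); unfold Q; lra).
  destruct (nfloor_ex (Q / c)) as [j [_ hj]]; [apply Rcomplements.Rdiv_le_0_compat; lra|].
  destruct (build (S j)) as [F [hF [pF wF]]].
  assert (qF : Q <= weight om F).
  { apply Rle_trans with (2 := wF). rewrite S_INR.
    replace Q with (Q / c * c) by (field; lra). apply Rmult_le_compat_r; lra. }
  destruct (list_max_bound (len o) F) as [M [pM hM]].
  pose proof (dist_ge_0 o (act f o)) as pf. fold (len o f) in pf.
  (* Chosen so that [exp (- e (len o f + M))] is at least 1/2; the [1] keeps the denominator
     positive. *)
  set (e := ln 2 / (len o f + M + 1)).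
  assert (ln2 : 0 < ln 2) by (rewrite <- ln_1; apply ln_increasing; lra).
  assert (pe : 0 < e) by (apply Rdiv_lt_0_compat; lra).
  apply Rbar_lt_le_trans with (om + e); [simpl; lra|].
  apply omega_grp_ge with F; [lra|exact pF|].
  pose proof (weight_shift om e M F ltac:(lra) hM) as ws.
  apply Rle_trans with (exp (- (om + e) * len o f) * (exp (- e * M) * Q)).
  2:{ apply Rmult_le_compat_l; [apply Rlt_le, exp_pos|]. apply Rle_trans with (2 := ws).
      apply Rmult_le_compat_l; [apply Rlt_le, exp_pos|exact qF]. }
  unfold Q.
  replace (exp (- (om + e) * len o f) * (exp (- e * M) * (4 * exp (om * len o f))))
    with (4 * (exp (- (om + e) * len o f) * exp (- e * M) * exp (om * len o f))) by ring.
  rewrite <- !exp_plus.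
  enough (exp (- ln 2) <= exp (- (om + e) * len o f + - e * M + om * len o f)).
  { rewrite exp_Ropp, exp_ln in H0; lra. }
  apply exp_monotone.
  assert (e * (len o f + M + 1) = ln 2) by (unfold e; field; lra). nra.
Qed.

End PingPong.
End Growth.

(** * Projections to contracting sets *)

Section MetricGeometry.
Context {X : MetricSpace}.
Hypothesis hgeod : geodesic_space X.
Implicit Types x y z p q r : X.

(** In a geodesic space this says that [z] lies on some geodesic from [x] to [y], without a
    parametrization. *)
Definition btw x z y : Prop := dist x z + dist z y = dist x y.

Lemma btw_sym x z y : btw x z y -> btw y z x.
Proof. unfold btw. rewrite (dist_sym X y z), (dist_sym X z x), (dist_sym X y x). lra. Qed.

Lemma point_at_distance x y t : 0 <= t <= dist x y ->
  exists z, btw x z y /\ dist x z = t.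
Proof.
  intros ht. destruct (hgeod x y) as [gam [g0 [g1 gd]]]. exists (gam t).
  pose proof (gd 0 t ltac:(lra) ht) as h0. pose proof (gd t (dist x y) ht ltac:(lra)) as h1.
  rewrite g0 in h0. rewrite g1 in h1.
  rewrite Rabs_minus_sym, Rabs_right in h0 by lra.
  rewrite Rabs_minus_sym, Rabs_right in h1 by lra. unfold btw. lra.
Qed.

Lemma btw_geodesic x z y : btw x z y ->
  exists gam, geodesic_segment x y gam /\ gam (dist x z) = z.
Proof.
  intros hb. unfold btw in hb.
  pose proof (dist_ge_0 x z). pose proof (dist_ge_0 z y).
  destruct (hgeod x z) as [c1 [c10 [c11 c1d]]]. destruct (hgeod z y) as [c2 [c20 [c21 c2d]]].
  set (a := dist x z) in *.
  set (gam := fun t => if Rle_dec t a then c1 t else c2 (t - a)).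
  assert (ga : forall t, t <= a -> gam t = c1 t).
  { intros t ht. unfold gam. destruct Rle_dec; [reflexivity|lra]. }
  assert (gb : forall t, a <= t -> gam t = c2 (t - a)).
  { intros t ht. unfold gam. destruct Rle_dec; [|reflexivity].
    replace t with a by lra. replace (a - a) with 0 by ring. now rewrite c11, c20. }
  (* A shortcut across [z] would make [x] and [y] closer than they are. *)
  assert (mixed : forall s t, 0 <= s <= a -> a <= t <= dist x y ->
            dist (c1 s) (c2 (t - a)) = t - s).
  { intros s t hs ht.
    pose proof (c1d 0 s ltac:(lra) hs) as d1. rewrite c10, Rabs_minus_sym, Rabs_right in d1 by lra.
    pose proof (c1d s a hs ltac:(lra)) as d2. rewrite c11, Rabs_minus_sym, Rabs_right in d2 by lra.
    pose proof (c2d 0 (t - a) ltac:(lra) ltac:(lra)) as d3.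
    rewrite c20, Rabs_minus_sym, Rabs_right in d3 by lra.
    pose proof (c2d (t - a) (dist z y) ltac:(lra) ltac:(lra)) as d4.
    rewrite c21, Rabs_minus_sym, Rabs_right in d4 by lra.
    pose proof (dist_tri X (c1 s) z (c2 (t - a))).
    pose proof (dist_tri X x (c1 s) y). pose proof (dist_tri X (c1 s) (c2 (t - a)) y). lra. }
  exists gam. split; [|rewrite ga by lra; exact c11].
  split; [|split].
  - rewrite ga by lra. exact c10.
  - rewrite gb by lra. replace (dist x y - a) with (dist z y) by lra. exact c21.
  - intros s t hs ht. destruct (Rle_lt_dec s a), (Rle_lt_dec t a).
    + rewrite !ga by lra. apply c1d; lra.
    + rewrite (ga s), (gb t), mixed by lra. rewrite Rabs_minus_sym, Rabs_right; lra.
    + rewrite (ga t), (gb s), dist_sym, mixed by lra. rewrite Rabs_right; lra.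
    + rewrite !gb by lra. rewrite c2d by lra. f_equal. ring.
Qed.

Definition isproj (A : X -> Prop) x p : Prop := A p /\ forall q, A q -> dist x p <= dist x q.

Lemma isproj_self (A : X -> Prop) x : A x -> isproj A x x.
Proof. intros hx. split; [exact hx|]. intros q _. rewrite dist_refl. apply dist_ge_0. Qed.

(** A point of [A] closer to [z] than [p] would also be closer to [x]. *)
Lemma isproj_btw (A : X -> Prop) x z p : isproj A x p -> btw x z p -> isproj A z p.
Proof.
  intros [hp hm] hb. split; [exact hp|]. intros q hq. unfold btw in hb.
  pose proof (hm q hq). pose proof (dist_tri X x z q). lra.
Qed.

Lemma isproj_nproj (A : X -> Prop) x p : isproj A x p -> nproj A x p.
Proof.
  intros [hp hm]. split; [exact hp|]. unfold setdist. apply is_glb_Rbar_unique. split.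
  - intros r [a [ha ->]]. simpl. now apply hm.
  - intros b hb. apply hb. now exists p.
Qed.

Section Contracting.
Variables (A : X -> Prop) (D : R).
Hypothesis D1 : 1 <= D.
Hypothesis contr : forall x y p q, isproj A x p -> isproj A y q ->
  dist x y + 1 <= dist x p -> dist p q <= D.
Hypothesis prox : forall x, exists p, isproj A x p.

(* Walk along [[x, y]] by jumps of length [d(x_i, A) - 1 >= 2 D], each moving the
   projection by at most [D]; [m] is [D] times the number of jumps. *)
Lemma march_to_contracting : forall n x y p, isproj A x p -> dist x y <= INR n ->
  exists m, 0 <= m /\
   ((exists z w, btw x z y /\ isproj A z w /\ dist z w <= 2 * D + 1 /\ dist p w <= m /\
       2 * m <= dist x z /\ dist x p - (2 * D + 1) + 2 * m <= dist x z) \/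
    ((forall q, isproj A y q -> dist p q <= m + D) /\ 2 * m <= dist x y /\
     (m = 0 \/ dist x p - (2 * D + 1) + 2 * m <= dist x y))).
Proof.
  induction n as [|n IH]; intros x y p hp hd; pose proof (dist_ge_0 x y);
    (destruct (Rle_lt_dec (dist x p) (2 * D + 1)) as [h1|h1];
     [exists 0; split; [lra|]; left; exists x, p; unfold btw; rewrite !dist_refl; repeat split;
        try lra; apply hp|]);
    (destruct (Rle_lt_dec (dist x y + 1) (dist x p)) as [h2|h2];
     [exists 0; split; [lra|]; right; repeat split; try lra; intros q hq;
        pose proof (contr x y p q hp hq h2); lra|]).
  - simpl in hd. lra.
  - rewrite S_INR in hd.
    (* The jump is longer than [2 * D], so [n] may decrease, and it stays in a ball missing [A]. *)
    destruct (point_at_distance x y (dist x p - 1)) as [x1 [b1 d1]]; [lra|].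
    destruct (prox x1) as [p1 hp1].
    assert (pp1 : dist p p1 <= D) by (apply (contr x x1); auto; lra).
    unfold btw in b1.
    destruct (IH x1 y p1 hp1 ltac:(lra)) as [m [hm [[z [w hz]]|hy]]].
    + destruct hz as [bz [hw [zw [p1w [m1 m2]]]]]. unfold btw in bz.
      pose proof (dist_tri X x x1 z). pose proof (dist_tri X x z y). pose proof (dist_tri X p p1 w).
      exists (m + D). split; [lra|]. left. exists z, w. unfold btw. repeat split; try lra; apply hw.
    + destruct hy as [h3 [h4 _]]. exists (m + D). split; [lra|]. right.
      repeat split; [|lra|right; lra]. intros q hq. specialize (h3 q hq).
      pose proof (dist_tri X p p1 q). lra.
Qed.

(** In the march from [x], the path advances [2 m] beyond [d(x, p)], up to a constant, while the
    projection drifts by [m] only. The triangle inequality through [p] gives [m <= 4 D + 2], whence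
    the bound [9 * D]. *)
Lemma btw_near_proj x y p q : isproj A x p -> isproj A y q ->
  dist p q <= 9 * D \/ exists z, btw x z y /\ dist p z <= 9 * D.
Proof.
  intros hp hq.
  assert (main : forall y' q', btw x y' y -> isproj A y' q' -> dist q q' <= D ->
            dist y q <= dist y y' + 1 -> dist p q <= 9 * D \/
            exists z, btw x z y /\ dist p z <= 9 * D).
  { intros y' q' hb hq' qq' dy'. unfold btw in hb.
    destruct (nfloor_ex (dist x y') (dist_ge_0 _ _)) as [n [_ hn]].
    destruct (march_to_contracting (S n) x y' p hp) as [m [hm [[z [w hz]]|hy]]].
    { rewrite S_INR. lra. }
    - destruct hz as [bz [hw [zw [pw [m1 m2]]]]]. unfold btw in bz. right. exists z.
      pose proof (dist_tri X z y' y). pose proof (dist_tri X x z y).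
      pose proof (dist_tri X x w z). pose proof (dist_tri X x p w). pose proof (dist_tri X p w z).
      rewrite (dist_sym X w z) in *. unfold btw. split; lra.
    - left. destruct hy as [h1 [h2 h3]]. specialize (h1 q' hq').
      pose proof (dist_tri X p q' q). rewrite (dist_sym X q' q) in *.
      destruct h3 as [->|h3]; [lra|].
      pose proof (dist_tri X x p y). pose proof (dist_tri X p q y).
      rewrite (dist_sym X q y), (dist_sym X y y') in *. lra. }
  destruct (Rle_lt_dec (dist y q) 1) as [h1|h1].
  { apply (main y q); auto; unfold btw; rewrite ?dist_refl; lra. }
  destruct (Rle_lt_dec (dist x y + 1) (dist y q)) as [h2|h2].
  { left. rewrite dist_sym. rewrite dist_sym in h2. pose proof (contr y x q p hq hp h2). lra. }
  (* Ending the march at this [y'] keeps its projection within [D] of [q], and the piece left out is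
     as long as the distance from [y] to [A], up to 1. *)
  destruct (point_at_distance y x (dist y q - 1)) as [y' [hb hd]].
  { rewrite (dist_sym X y x). lra. }
  destruct (prox y') as [q' hq'].
  apply (main y' q'); auto; [now apply btw_sym| |lra].
  apply (contr y y'); auto. lra.
Qed.

Let C := 9 * D.

Lemma btw_near_proj_mem x y p : isproj A x p -> A y -> exists z, btw x z y /\ dist p z <= C.
Proof.
  intros hp hy. destruct (btw_near_proj x y p y hp (isproj_self A y hy)) as [h|h]; [|exact h].
  exists y. unfold btw. rewrite dist_refl. split; [lra|exact h].
Qed.

Lemma dist_through_proj x y p : isproj A x p -> A y ->
  dist x p + dist p y <= dist x y + 2 * C.
Proof.
  intros hp hy. destruct (btw_near_proj_mem x y p hp hy) as [z [hb hz]]. unfold btw in hb.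
  pose proof (dist_tri X x z p). pose proof (dist_tri X p z y). rewrite (dist_sym X z p) in *. lra.
Qed.

(** The geodesics from [z] to [x] and to [y] pass within [C] of the projection [r], at [w] and [v].
    These lie on opposite sides of [z] and at most [2 C] apart, so one is within [C] of [z]. *)
Lemma contracting_quasi_convex x y z : A x -> A y -> btw x z y -> exists r, A r /\ dist z r <= 2 * C.
Proof.
  intros hx hy hb. destruct (prox z) as [r hr]. exists r. split; [apply hr|].
  destruct (btw_near_proj_mem z x r hr hx) as [w [bw dw]].
  destruct (btw_near_proj_mem z y r hr hy) as [v [bv dv]].
  unfold btw in *.
  pose proof (dist_tri X x w y). pose proof (dist_tri X w v y). pose proof (dist_tri X w r v).
  pose proof (dist_tri X z w r). pose proof (dist_tri X z v r).
  rewrite (dist_sym X w r), (dist_sym X v r), (dist_sym X x w), (dist_sym X x z) in *. lra.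
Qed.

(** Either [y] lies in a ball around [x] missing [A] and contraction applies, or [x] is within
    [d(x, y) + 1] of [A]. *)
Lemma proj_lipschitz x y p q : isproj A x p -> isproj A y q ->
  dist p q <= D + 4 * dist x y + 2.
Proof.
  intros hp hq. pose proof (dist_ge_0 x y).
  destruct (Rle_lt_dec (dist x y + 1) (dist x p)) as [h|h].
  - pose proof (contr x y p q hp hq h). lra.
  - destruct hp as [hp _]. destruct hq as [hq mq]. pose proof (mq p hp).
    pose proof (dist_tri X y x p). pose proof (dist_tri X p x q). pose proof (dist_tri X x y q).
    rewrite (dist_sym X y x), (dist_sym X p x) in *. lra.
Qed.

End Contracting.
End MetricGeometry.

(** * Contracting axes and transversality *)

Section Axis.
Context {G : Group} {X : MetricSpace} (act : G -> X -> X).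
Hypotheses (hgeod : geodesic_space X) (hiso : isometric_action act) (hprop : proper_action act).

Lemma dist_act g x y : dist (act g x) (act g y) = dist x y.
Proof. apply hiso. Qed.

Lemma act_mul g h x : act (gmul g h) x = act g (act h x).
Proof. apply hiso. Qed.

Lemma act_one x : act gone x = x.
Proof. apply hiso. Qed.

Lemma btw_act g x z y : btw (act g x) (act g z) (act g y) <-> btw x z y.
Proof. unfold btw. now rewrite !dist_act. Qed.

Definition orbit (K : G -> Prop) (b : X) (x : X) : Prop := exists k, K k /\ x = act k b.

Lemma orbit_base K b : is_subgroup K -> orbit K b b.
Proof. intros hK. exists gone. split; [apply hK|now rewrite act_one]. Qed.

Lemma orbit_act K b k x : is_subgroup K -> K k -> orbit K b x -> orbit K b (act k x).
Proof. intros hK hk [j [hj ->]]. exists (gmul k j). split; [now apply hK|now rewrite act_mul]. Qed.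

(** By properness only finitely many [k] move [b] by at most [2 d(x, b)]; the others put [b] farther
    from [x] than it was. *)
Lemma orbit_proximinal K b x : is_subgroup K -> exists p, isproj (orbit K b) x p.
Proof.
  intros hK. destruct (hprop b (dist x b + dist x b)) as [l hl].
  destruct (list_minimizer (fun k => dist x (act k b)) K l) as [k [hk hm]].
  { exists gone. split; [|apply hK]. apply hl. rewrite act_one, dist_refl.
    pose proof (dist_ge_0 x b). lra. }
  exists (act k b). split; [now exists k|]. intros q [j [hj ->]].
  destruct (classic (In j l)) as [i|i]; [now apply hm|].
  assert (dist x b + dist x b < dist b (act j b)) by (apply Rnot_le_lt; intros c; apply i, hl, c).
  assert (i1 : In gone l).
  { apply hl. rewrite act_one, dist_refl. pose proof (dist_ge_0 x b). lra. }
  pose proof (hm gone i1 (proj1 hK)) as h1. rewrite act_one in h1.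
  pose proof (dist_tri X b x (act j b)). rewrite (dist_sym X b x) in *. lra.
Qed.

Lemma isproj_act K b k x p : is_subgroup K -> K k ->
  isproj (orbit K b) x p -> isproj (orbit K b) (act k x) (act k p).
Proof.
  intros hK hk [hp hm]. split; [now apply orbit_act|]. intros q hq.
  rewrite dist_act, <- (act_inv_r act hiso k q), dist_act. apply hm.
  apply orbit_act; auto. now apply hK.
Qed.

Lemma strongly_contracting_isproj (A : X -> Prop) delta : strongly_contracting_set A delta ->
  forall x y p q, isproj A x p -> isproj A y q -> dist x y + 1 <= dist x p ->
    dist p q <= Rmax 1 delta.
Proof.
  intros hsc x y p q hp hq h.
  assert (lt : Rbar_lt (dist p q) delta); [|simpl in lt; pose proof (Rmax_r 1 delta); lra].
  eapply Rbar_le_lt_trans; [|apply (hsc x (dist x p - 1))].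
  - unfold diam. apply Lub_Rbar_correct. exists p, q. split; [|split; [|reflexivity]].
    + exists x. split; [|now apply isproj_nproj]. rewrite dist_refl. pose proof (dist_ge_0 x y). lra.
    + exists y. split; [lra|now apply isproj_nproj].
  - intros z hz ha. destruct hp as [_ hm]. specialize (hm z ha). lra.
Qed.

Lemma gzpow_conj_mul (g c : G) t s n : gmul (gzpow g t) c = gmul c (gzpow g s) ->
  gmul (gzpow g (t * n)) c = gmul c (gzpow g (s * n)).
Proof.
  intros e. induction n as [|n IH|n IH] using Z.peano_ind.
  - rewrite !Z.mul_0_r. simpl. grp.
  - rewrite !Z.mul_succ_r, !gzpow_add, <- gmul_assoc, e, gmul_assoc, IH. grp.
  - rewrite !Z.mul_pred_r. unfold Z.sub. rewrite !gzpow_add, !gzpow_opp, <- gmul_assoc.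
    assert (e' : gmul (ginv (gzpow g t)) c = gmul c (ginv (gzpow g s))).
    { apply (gmul_cancel_l (gzpow g t)). rewrite !gmul_assoc, e. grp. }
    rewrite e', gmul_assoc, IH. grp.
Qed.

(** [g^t c = c g^s] gives [g^(i + t n) c <g> = g^i c <g>], so [i] matters only modulo [t]. *)
Lemma double_coset_finite (g c : G) : exists lc : list G,
  forall t s i j, t <> 0%Z -> gmul (gzpow g t) c = gmul c (gzpow g s) ->
    exists a, In a lc /\ cyclic g (gmul (ginv a) (gmul (gmul (gzpow g i) c) (gzpow g j))).
Proof.
  destruct (classic (exists t s, t <> 0%Z /\ gmul (gzpow g t) c = gmul c (gzpow g s)))
    as [[t [s [ht e]]]|no]; [|exists nil; intros t s i j ht e; destruct no; eauto].
  (* The exponents from [- |t|] to [|t|] include [i mod t] for either sign of [t]. *)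
  set (lc := map (fun n => gmul (gzpow g (Z.of_nat n - Z.abs t)) c)
               (seq 0 (Z.to_nat (2 * Z.abs t + 1)))).
  exists lc. intros _ _ i j _ _.
  exists (gmul (gzpow g (i mod t)) c). split.
  - apply in_map_iff. exists (Z.to_nat (i mod t + Z.abs t)).
    assert (- Z.abs t <= i mod t <= Z.abs t)%Z.
    { destruct (Z_lt_le_dec t 0).
      - pose proof (Z.mod_neg_bound i t). lia.
      - pose proof (Z.mod_pos_bound i t). lia. }
    split; [|apply in_seq; lia].
    rewrite Z2Nat.id by lia. do 2 f_equal. lia.
  - exists (s * (i / t) + j)%Z.
    rewrite (Z.div_mod i t ht) at 2. rewrite Z.add_comm, !gzpow_add.
    apply (gmul_cancel_l (gmul (gzpow g (i mod t)) c)).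
    rewrite (gmul_assoc G (gmul (gzpow g (i mod t)) c)), gmul_Vr, gmul_1l.
    rewrite <- !gmul_assoc, (gmul_assoc G (gzpow g (t * (i / t))) c), (gzpow_conj_mul g c t s _ e). grp.
Qed.

Lemma double_cosets_finite (g : G) (l : list G) : exists L : list G,
  forall c t s i j, In c l -> t <> 0%Z -> gmul (gzpow g t) c = gmul c (gzpow g s) ->
    exists a, In a L /\ cyclic g (gmul (ginv a) (gmul (gmul (gzpow g i) c) (gzpow g j))).
Proof.
  induction l as [|c l [L IH]]; [exists nil; intros c t s i j []|].
  destruct (double_coset_finite g c) as [lc hc]. exists (lc ++ L).
  intros c' t s i j [<-|hin] ht e.
  - destruct (hc t s i j ht e) as [a [ha hk]]. exists a. split; auto. apply in_or_app; auto.
  - destruct (IH c' t s i j hin ht e) as [a [ha hk]]. exists a. split; auto. apply in_or_app; auto.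
Qed.

Definition quasi_convex_at (H : G -> Prop) (o : X) (eta : R) : Prop :=
  forall h1 h2 z, H h1 -> H h2 -> btw (act h1 o) z (act h2 o) ->
    exists h, H h /\ dist z (act h o) <= eta.

Lemma quasi_convex_btw H : quasi_convex act H ->
  exists o eta, 0 <= eta /\ quasi_convex_at H o eta.
Proof.
  intros [o [eta [he hq]]]. exists o, eta. split; [exact he|]. intros h1 h2 z H1 H2 hb.
  destruct (btw_geodesic hgeod _ _ _ hb) as [gam [hg hz]]. rewrite <- hz.
  apply (hq h1 h2); auto. unfold btw in hb.
  pose proof (dist_ge_0 (act h1 o) z). pose proof (dist_ge_0 z (act h2 o)). lra.
Qed.

(** Cut a geodesic from [o] to [h o] at distance [r], or at its end if it is shorter, and replace
    the cut by a nearby point of [H o]. *)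
Lemma quasi_convex_split H o eta : is_subgroup H -> 0 <= eta -> quasi_convex_at H o eta ->
  forall h r t, H h -> 0 <= r -> 0 <= t -> len act o h <= r + t ->
  exists k, H k /\ len act o k <= r + eta /\ len act o (gmul (ginv k) h) <= t + eta.
Proof.
  intros hH he hq h r t hh hr ht hl. unfold len in *. pose proof (dist_ge_0 o (act h o)).
  destruct (point_at_distance hgeod o (act h o) (Rmin r (dist o (act h o)))) as [z [hb hd]].
  { split; [now apply Rmin_glb|apply Rmin_r]. }
  destruct (hq gone h z) as [k [hk dk]]; [apply hH|exact hh|now rewrite act_one|].
  exists k. split; [exact hk|]. unfold btw in hb.
  rewrite act_mul, (dist_sym X o (act (ginv k) _)), dist_act_inv by exact hiso.
  pose proof (dist_tri X o z (act k o)). pose proof (dist_tri X (act k o) z (act h o)).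
  rewrite (dist_sym X (act k o) z), (dist_sym X (act h o)) in *.
  revert hd. unfold Rmin. destruct Rle_dec; lra.
Qed.

Section ContractingAxis.
Variables (g : G) (b : X) (D : R).
Hypothesis g_inf : forall n : nat, (0 < n)%nat -> gpow g n <> gone.
Hypothesis D1 : 1 <= D.
Let K := cyclic g.
Let A := orbit K b.
Hypothesis contr : forall x y p q, isproj A x p -> isproj A y q ->
  dist x y + 1 <= dist x p -> dist p q <= D.
Let hK : is_subgroup K := cyclic_subgroup g.
Let prox : forall x, exists p, isproj A x p := fun x => orbit_proximinal K b x hK.
Let C := 9 * D.

(** Otherwise every [e] is some [g^i c g^j] with [c] in a finite list and conjugating a nontrivial
    power of [g] into [<g>]. Such products fill finitely many cosets of [<g>], so [G] would be
    virtually cyclic. *)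
Lemma exists_transverse_translate : ~ virtually_cyclic G ->
  exists e E, forall y q, A y -> isproj A (act e y) q -> dist q b <= E.
Proof.
  intros hv. apply NNPP. intros no. apply hv. exists K. split; [exact hK|]. split; [|now exists g].
  assert (unb : forall e E, exists y q, A y /\ isproj A (act e y) q /\ E < dist q b).
  { intros e E. apply NNPP. intros n. apply no. exists e, E. intros y q hy hq.
    apply Rnot_lt_le. intros c. apply n. eauto. }
  destruct (hprop b (3 * C)) as [l hl].
  assert (near : forall e, exists c i j t s, In c l /\ t <> 0%Z /\
            gmul (gzpow g t) c = gmul c (gzpow g s) /\ e = gmul (gmul (gzpow g i) c) (gzpow g j)).
  { intros e.
    destruct (uniform_choice (fun R c => In c l /\ exists i j, R < dist (act (gzpow g i) b) b /\
                 e = gmul (gmul (gzpow g i) c) (gzpow g j)) l) as [c hc].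
    - intros r s c rs [hc [i [j [h1 h2]]]]. split; auto. exists i, j. split; auto. lra.
    (* A geodesic between two points of [e A] with distant projections passes within [C] of [q] and
       stays within [2 C] of [e A], so some [g^-i e g^j] moves [b] by at most [3 C]. *)
    - intros R0. destruct (unb e R0) as [y [q [hy [hq Rq]]]].
      destruct (unb e (dist q b + C)) as [y' [q' [hy' [hq' Rq']]]].
      destruct (btw_near_proj hgeod A D D1 contr prox _ _ q q' hq hq') as [h|[z [hb hz]]].
      { fold C in h. pose proof (dist_tri X q' q b). rewrite (dist_sym X q' q) in *. lra. }
      fold C in hz. rewrite <- (act_inv_r act hiso e z), btw_act in hb.
      destruct (contracting_quasi_convex hgeod A D D1 contr prox _ _ _ hy hy' hb) as [r [hr dr]].
      fold C in dr. rewrite dist_act_inv in dr by exact hiso.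
      destruct (proj1 hq) as [k [[i ->] ->]]. destruct hr as [k' [[j ->] ->]].
      exists (gmul (gmul (ginv (gzpow g i)) e) (gzpow g j)).
      assert (hin : In (gmul (gmul (ginv (gzpow g i)) e) (gzpow g j)) l).
      { apply hl. rewrite dist_sym, !act_mul, dist_act_inv by exact hiso.
        pose proof (dist_tri X (act (gzpow g i) b) z (act e (act (gzpow g j) b))).
        rewrite (dist_sym X (act e _)). lra. }
      repeat split; auto. exists i, (- j)%Z. split; auto. rewrite gzpow_opp. grp.
    - destruct (hc 0) as [hcl [i [j [_ e1]]]].
      (* Requiring a larger displacement than that of [g^i] forces [i'] to differ from [i]; equating
         the two expressions of [e] gives the relation. *)
      destruct (hc (dist (act (gzpow g i) b) b)) as [_ [i' [j' [h2 e2]]]].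
      exists c, i, j, (i - i')%Z, (j' - j)%Z. split; [exact hcl|]. split; [|split; [|exact e1]].
      + intros h. assert (i = i') as <- by lia. lra.
      + unfold Z.sub. rewrite Z.add_comm, !gzpow_add, !gzpow_opp.
        apply (gmul_cancel_l (gzpow g i')). apply (gmul_cancel_r (gzpow g j)).
        autorewrite with grp. now rewrite <- e1, <- e2. }
  destruct (double_cosets_finite g l) as [L hL]. exists L. intros e.
  destruct (near e) as [c [i [j [t [s [hc [ht [ec ->]]]]]]]]. apply (hL c t s i j); auto.
Qed.

(** * A translate of the axis transverse to the subgroup *)

Section Subgroup.
Variables (H : G -> Prop) (o : X) (eta : R).
Hypotheses (hH : is_subgroup H) (hinf : ~ finite_index H)
  (heta : 0 <= eta) (hqc : quasi_convex_at H o eta).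

(** If every [w H o] came within [M] of [b], properness would leave finitely many representatives of
    the cosets [w H]. *)
Lemma far_translate M : exists w, forall h, H h -> M < dist b (act w (act h o)).
Proof.
  apply NNPP. intros no. apply hinf.
  destruct (hprop o (M + dist b o)) as [l hl]. exists l. intros w.
  assert (ex : exists h, H h /\ dist b (act w (act h o)) <= M).
  { apply NNPP. intros n. apply no. exists w. intros h hh. apply Rnot_le_lt. intros c. apply n. eauto. }
  destruct ex as [h [hh hd]]. exists (gmul w h). split.
  - apply hl. rewrite act_mul. pose proof (dist_tri X o b (act w (act h o))).
    rewrite (dist_sym X o b) in *. lra.
  - rewrite ginv_mul, <- gmul_assoc, gmul_Vl, gmul_1r. now apply hH.
Qed.

(** Two points of [w H o] with distant projections are joined by a geodesic passing near the axis,
    and quasi-convexity supplies an orbit point there. *)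
Lemma proj_near_of_unbounded w :
  (forall R, exists h p, H h /\ isproj A (act w (act h o)) p /\ R < dist p b) ->
  exists h p, H h /\ A p /\ dist p (act w (act h o)) <= C + eta.
Proof.
  intros unb. destruct (unb 0) as [h1 [p1 [hh1 [hp1 _]]]].
  destruct (unb (dist p1 b + C)) as [h2 [p2 [hh2 [hp2 far]]]].
  destruct (btw_near_proj hgeod A D D1 contr prox _ _ p2 p1 hp2 hp1) as [h|[z [hb hz]]].
  { fold C in h. pose proof (dist_tri X p2 p1 b). lra. }
  fold C in hz. rewrite <- (act_inv_r act hiso w z), btw_act in hb.
  destruct (hqc h2 h1 _ hh2 hh1 hb) as [h [hh dh]]. rewrite dist_act_inv in dh by exact hiso.
  exists h, p2. split; [exact hh|]. split; [apply hp2|].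
  pose proof (dist_tri X p2 z (act w (act h o))). lra.
Qed.

(* If both [w H o] and [e^-1 w H o] had unbounded projections to the axis, a geodesic with
   endpoints in [w H o] would pass near [b], which is far from [w H o]. *)
Lemma exists_transverse_subgroup e E :
  (forall y q, A y -> isproj A (act e y) q -> dist q b <= E) ->
  exists w B, forall h p, H h -> isproj A (act w (act h o)) p -> dist p b <= B.
Proof.
  intros he. set (L := D + 4 * (C + eta) + 2).
  destruct (far_translate (E + 2 * L + 2 * C + 2 * eta)) as [w hw].
  apply NNPP. intros no.
  assert (unb : forall w R, exists h p, H h /\ isproj A (act w (act h o)) p /\ R < dist p b).
  { intros v R0. apply NNPP. intros n. apply no. exists v, R0. intros h p hh hp.
    apply Rnot_lt_le. intros c. apply n. eauto. }
  destruct (proj_near_of_unbounded w (unb w)) as [h1 [p1 [hh1 [hp1 d1]]]].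
  destruct (proj_near_of_unbounded (gmul (ginv e) w) (unb _)) as [h2 [p2 [hh2 [hp2 d2]]]].
  rewrite act_mul, dist_sym, dist_act_inv in d2 by exact hiso.
  destruct (prox (act w (act h1 o))) as [r1 hr1]. destruct (prox (act w (act h2 o))) as [r2 hr2].
  destruct (prox (act e p2)) as [q2 hq2]. pose proof (he p2 q2 hp2 hq2) as b2.
  pose proof (proj_lipschitz A D D1 contr _ _ _ _ (isproj_self A p1 hp1) hr1) as l1.
  pose proof (proj_lipschitz A D D1 contr _ _ _ _ hr2 hq2) as l2.
  pose proof (dist_tri X r2 q2 b).
  pose proof (dist_ge_0 q2 b). pose proof (dist_ge_0 r2 q2). pose proof (dist_ge_0 p1 r1).
  (* Here [r2] is near [b], and [r1] near [p1], hence near [w h1 o]. If [r1] and [r2] are close,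
     [w h1 o] is itself near [b]; otherwise the geodesic passes near [r2]. *)
  destruct (btw_near_proj hgeod A D D1 contr prox _ _ r2 r1 hr2 hr1) as [h|[z [hb hz]]].
  - fold C in h. specialize (hw h1 hh1).
    pose proof (dist_tri X b r2 r1). pose proof (dist_tri X b r1 p1).
    pose proof (dist_tri X b p1 (act w (act h1 o))).
    rewrite (dist_sym X r1 p1), (dist_sym X b r2) in *. unfold L in hw. unfold C in *. lra.
  - fold C in hz. rewrite <- (act_inv_r act hiso w z), btw_act in hb.
    destruct (hqc h2 h1 _ hh2 hh1 hb) as [h [hh dh]]. rewrite dist_act_inv in dh by exact hiso.
    specialize (hw h hh). pose proof (dist_tri X b r2 (act w (act h o))).
    pose proof (dist_tri X r2 z (act w (act h o))).
    rewrite (dist_sym X b r2) in *. unfold L in hw. unfold C in *. lra.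
Qed.

End Subgroup.

(** * Ping-pong on the axis *)

Section PingPong.
Variables (H : G -> Prop) (o : X) (B : R).
Hypothesis hH : is_subgroup H.
Hypothesis hB : forall h p, H h -> isproj A (act h o) p -> dist p b <= B.

(** If [h y] projects to [q] far from [b], some [h y'] of [h A] is near [q]. Measuring through
    projections near [b], up to constants [|h| + d(b, q) <= d(b, y')] and
    [|h| + d(b, y') <= d(b, q)]; adding them bounds [|h|]. *)
Lemma translates_transverse : exists M R1, forall h y q, H h -> M < len act o h -> A y ->
  isproj A (act h y) q -> dist q b <= R1.
Proof.
  set (k := dist o b).
  exists (2 * k + 2 * B + 6 * C), (B + D + 4 * k + 2 + C).
  intros h y q hh hM hy hq. apply Rnot_lt_le. intros far. unfold len in hM.
  destruct (prox (act h o)) as [r hr]. destruct (prox (act h b)) as [r' hr'].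
  pose proof (hB h r hh hr) as rB.
  pose proof (proj_lipschitz A D D1 contr _ _ _ _ hr hr') as l1. rewrite dist_act in l1. fold k in l1.
  destruct (btw_near_proj hgeod A D D1 contr prox _ _ q r' hq hr') as [c|[z [hb hz]]].
  { fold C in c. pose proof (dist_tri X q r' b). pose proof (dist_tri X r' r b).
    rewrite (dist_sym X r' r) in *. lra. }
  fold C in hz. rewrite <- (act_inv_r act hiso h z), btw_act in hb.
  destruct (contracting_quasi_convex hgeod A D D1 contr prox _ _ _ hy (orbit_base K b hK) hb)
    as [y' [hy' dy']].
  fold C in dy'. rewrite dist_act_inv in dy' by exact hiso.
  assert (qy : dist q (act h y') <= 3 * C) by (pose proof (dist_tri X q z (act h y')); lra).
  pose proof (dist_through_proj hgeod A D D1 contr prox _ q r hr (proj1 hq)) as t1. fold C in t1.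
  destruct (prox (act (ginv h) o)) as [r3 hr3].
  pose proof (hB (ginv h) r3 ltac:(now apply hH) hr3) as r3B.
  pose proof (dist_through_proj hgeod A D D1 contr prox _ y' r3 hr3 hy') as t3. fold C in t3.
  rewrite (dist_act_inv act hiso h o y') in t3.
  pose proof (len_inv act hiso o h) as li. unfold len in li.
  pose proof (dist_tri X (act h o) (act h y') q) as i1. rewrite dist_act in i1.
  pose proof (dist_tri X o b y') as i2. fold k in i2.
  pose proof (dist_tri X o b (act h o)) as i3. fold k in i3.
  pose proof (dist_tri X b r (act h o)) as i4.
  pose proof (dist_tri X b r q) as i5.
  pose proof (dist_tri X o q (act h y')) as i6.
  pose proof (dist_tri X o b q) as i7. fold k in i7.
  pose proof (dist_tri X o b (act (ginv h) o)) as i8. fold k in i8.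
  pose proof (dist_tri X b r3 (act (ginv h) o)) as i9.
  pose proof (dist_tri X b r3 y') as i10.
  rewrite (dist_sym X b r), (dist_sym X b r3), (dist_sym X r (act h o)),
    (dist_sym X r3 (act (ginv h) o)), (dist_sym X (act h y') q) in *.
  pose proof (dist_ge_0 b q). unfold C in *. lra.
Qed.

Lemma exists_ping_pong : exists Far f Phi, ping_pong H Far f Phi.
Proof.
  destruct translates_transverse as [M [R1 hM]].
  set (R0 := R1 + D + 5 * C + 3).
  destruct (hprop o M) as [Phi hPhi]. destruct (hprop b (2 * R0)) as [lf hlf].
  (* Such an [f] carries projections within [R0] of [b] beyond [R0]. *)
  assert (ex : exists f, K f /\ 2 * R0 < dist b (act f b)).
  { apply NNPP. intros no. apply (cyclic_infinite g g_inf). exists lf. intros k hk.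
    apply hlf, Rnot_lt_le. intros c. apply no. eauto. }
  destruct ex as [f [hf far]].
  exists (fun y => exists p, isproj A (act y o) p /\ R0 < dist p b), f, Phi. split.
  - intros h y hh [q0 [hq0 fq]] [p [hp fp]]. rewrite act_mul in hp.
    apply hPhi, Rnot_lt_le. intros hlen.
    assert (hlen' : M < len act o (ginv h)) by (rewrite len_inv; auto).
    destruct (prox (act (ginv h) p)) as [r hr].
    pose proof (hM (ginv h) p r ltac:(now apply hH) hlen' (proj1 hp) hr) as rR.
    (* As [h^-1 p] projects near [b], the geodesic to it from [y o] passes near [q0]. The [h]-image
       of that passage still projects to [p], yet is near [h q0], which projects near [b]: this
       contradicts [fp]. *)
    destruct (btw_near_proj hgeod A D D1 contr prox _ _ q0 r hq0 hr) as [c|[z [hb hz]]].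
    { fold C in c. pose proof (dist_tri X q0 r b). unfold R0, C in *. lra. }
    fold C in hz. rewrite <- (btw_act h), act_inv_r in hb by exact hiso.
    pose proof (isproj_btw A _ _ _ hp hb) as hpz.
    destruct (prox (act h q0)) as [p' hp'].
    pose proof (hM h q0 p' hh hlen (proj1 hq0) hp') as pR.
    pose proof (proj_lipschitz A D D1 contr _ _ _ _ hpz hp') as lip.
    rewrite dist_act, (dist_sym X z q0) in lip.
    pose proof (dist_tri X p p' b). unfold R0, C in *. lra.
  - intros y hy. destruct (prox (act y o)) as [p hp].
    assert (hpb : dist p b <= R0) by (apply Rnot_lt_le; intros c; apply hy; eauto).
    exists (act f p). split.
    + rewrite act_mul. now apply isproj_act.
    + pose proof (dist_tri X b (act f p) (act f b)) as i. rewrite dist_act in i.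
      rewrite (dist_sym X b (act f p)) in i. lra.
Qed.

End PingPong.

Lemma exists_ping_pong_quasi_convex H o eta : ~ virtually_cyclic G -> is_subgroup H ->
  ~ finite_index H -> 0 <= eta -> quasi_convex_at H o eta ->
  exists Far f Phi, ping_pong H Far f Phi.
Proof.
  intros hv hH hinf heta hqc.
  destruct (exists_transverse_translate hv) as [e [E he]].
  destruct (exists_transverse_subgroup H o eta hH hinf heta hqc e E he) as [w [B hB]].
  (* Transversality concerns [w H o], the orbit of [w o] under [w H w^-1]; the ping-pong found there
     is conjugated back. *)
  set (H' := fun k => H (gmul (gmul (ginv w) k) w)).
  destruct (exists_ping_pong H' (act w o) B) as [Far [f [Phi [k1 k2]]]].
  - destruct hH as [h1 [hm hi]]. unfold H'. repeat split.
    + now grp.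
    + intros a c ha hc. specialize (hm _ _ ha hc). revert hm. now grp.
    + intros a ha. specialize (hi _ ha). revert hi. now grp.
  - intros h p hh. rewrite <- act_mul.
    replace (gmul h w) with (gmul w (gmul (gmul (ginv w) h) w)) by grp.
    rewrite act_mul. now apply hB.
  - exists (fun y => Far (gmul w y)), (gmul (gmul (ginv w) f) w),
      (map (fun k => gmul (gmul (ginv w) k) w) Phi). split.
    + intros h y hh fy fhy. apply in_map_iff. exists (gmul (gmul w h) (ginv w)).
      split; [grp|]. apply (k1 _ (gmul w y)); auto.
      * unfold H'. now grp.
      * revert fhy. now grp.
    + intros y hy. apply k2 in hy. revert hy. now grp.
Qed.

Lemma omega_sub_lt_grp H o eta : ~ virtually_cyclic G -> is_subgroup H ->
  ~ finite_index H -> 0 <= eta -> quasi_convex_at H o eta ->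
  (~ exists l, forall h, H h -> In h l) ->
  forall x, Rbar_lt (omega_sub act H x) (omega_grp act x).
Proof.
  intros hv hH hinf heta hqc inf x.
  destruct (exists_ping_pong_quasi_convex H o eta hv hH hinf heta hqc) as [Far [f [Phi hpp]]].
  eapply Rbar_le_lt_trans; [apply (omega_sub_base act hiso H x o)|].
  eapply Rbar_lt_le_trans; [|apply (omega_grp_base act hiso o x)].
  apply (omega_sub_lt_grp_of_split act hiso H Far f Phi hH hpp o eta heta); auto.
  - now apply quasi_convex_split.
  - intros r. destruct (hprop o r) as [l hl].
    apply (finite_enum (fun h => H h /\ len act o h <= r) l). intros h [_ hr]. now apply hl.
Qed.

End ContractingAxis.
End Axis.

(** * Comparison of the growth exponents *)

Theorem mainTheorem4 (G : Group) (X : MetricSpace) (act : G -> X -> X)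
  (hgeod : geodesic_space X) (hiso : isometric_action act) (hprop : proper_action act)
  (hnvc : ~ virtually_cyclic G)
  (hsc : exists g : G, strongly_contracting_elt act g)
  (H : G -> Prop) (hH : is_subgroup H) (hinf : ~ finite_index H)
  (hqc : quasi_convex act H) :
  forall o : X,
    Rbar_lt (omega_sub act H o) (omega_grp act o) /\
    omega_left_cosets act H o = omega_grp act o /\
    omega_right_cosets act H o = omega_grp act o.
Proof.
  destruct hsc as [g [g_inf [b [delta [_ hset]]]]].
  set (D := Rmax 1 delta). pose proof (Rmax_l 1 delta : 1 <= D) as D1.
  set (A := orbit act (cyclic g) b).
  assert (contr : forall x y p q, isproj A x p -> isproj A y q ->
            dist x y + 1 <= dist x p -> dist p q <= D).
  { assert (eA : forall x p, isproj A x p ->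
              isproj (fun y => exists k : Z, y = act (gzpow g k) b) x p).
    { intros x p [[k [[n ->] ->]] hm]. split; [now exists n|].
      intros q [m ->]. apply hm. exists (gzpow g m). split; [now exists m|reflexivity]. }
    intros x y p q hp hq. apply (strongly_contracting_isproj _ delta hset); auto. }
  destruct (quasi_convex_btw act hgeod H hqc) as [o1 [eta [heta hq]]].
  destruct (exists_ping_pong_quasi_convex act hgeod hiso hprop g b D g_inf D1 contr
              H o1 eta hnvc hH hinf heta hq) as [Far [f [Phi hpp]]].
  intros o. split.
  - destruct (classic (exists l, forall h, H h -> In h l)) as [[l hl]|inf].
    (* For finite [H] the counts are at most [|l|] times those of [<g>], which contain [gone]. *)
    + apply Rbar_le_lt_trans with (omega_sub act (cyclic g) o).
      * apply growth_rate_compare with (K := length l) (c := 0);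
          try (intros; apply card_classes_pos); [lra|].
        intros r n hr hn. exists 1%nat. split.
        -- apply card_classes_ge. exists (gone :: nil). split; [|split; [|reflexivity]].
           ++ intros a [<-|[]]. split; [|apply cyclic_subgroup].
              unfold ballG. rewrite (act_one act hiso), dist_refl. lra.
           ++ simpl. split; [intros ? []|exact I].
        -- apply card_classes_ge in hn as [l' [hl' [pl <-]]]. rewrite Nat.mul_1_r.
           apply NoDup_incl_length; [now apply pairwise_inequiv_eq|].
           intros a ha. now apply hl, hl'.
      (* The infinite case applies to [<g>]: its orbit is contracting, hence quasi-convex, and its
         index is infinite because [G] is not virtually cyclic. *)
      * apply (omega_sub_lt_grp act hgeod hiso hprop g b D g_inf D1 contr (cyclic g) b (2 * (9 * D)));
          auto; [apply cyclic_subgroup| |lra| |now apply cyclic_infinite].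
        -- intros hf. apply hnvc. exists (cyclic g). split; [apply cyclic_subgroup|].
           split; [exact hf|now exists g].
        -- intros h1 h2 z hh1 hh2 hb.
           destruct (contracting_quasi_convex hgeod A D D1 contr
             (fun x => orbit_proximinal act hiso hprop (cyclic g) b x (cyclic_subgroup g))
             (act h1 b) (act h2 b) z) as [r [[k [hk ->]] hr]];
             [now exists h1|now exists h2|exact hb|]. now exists k.
    + now apply (omega_sub_lt_grp act hgeod hiso hprop g b D g_inf D1 contr H o1 eta).
  - rewrite omega_left_right_cosets by exact hiso.
    split; apply (omega_right_cosets_eq act hiso H Far f Phi hH hpp).
Qed.
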